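(* Consider an instance of the Colored Knapsack Problem and let $\tilde c\in\mathcal{C}$ be a (given) color that is critical in at least one optimal solution of $\text{LP}_{\text{CKP}}$. Let $g_i=1$ if $\kappa_i=\tilde c$ and $g_i=-1$ otherwise. Then an optimal solution to the linear program $$\max\Big\{\sum_{i\in\mathcal{I}}p_ix_i \;\Big|\; \sum_{i\in\mathcal{I}}w_ix_i\le b,\ \ \sum_{i\in\mathcal{I}}g_ix_i=1,\ \ 0\le x_i\le 1\ \text{ for all } i\in\mathcal{I}\Big\}$$ can be computed in $\mathcal{O}(n)$ time.
   Context: An instance of the Colored Knapsack Problem (CKP) consists of a set of items $\mathcal{I}=\{1,\dots,n\}$ with profits $p_i\in\mathbb{Z}$ (zero and negative profits allowed) and weights $w_i\in\mathbb{Z}_{>0}$, a capacity $b\in\mathbb{Z}_{>0}$ with $b<\sum_{i=1}^n w_i$, a set of colors $\mathcal{C}=\{1,\dots,m\}$, and a color $\kappa_i\in\mathcal{C}$ for each item $i$. For $c\in\mathcal{C}$ let $\mathcal{I}_c=\{i\in\mathcal{I}\mid \kappa_i=c\}$ and $\bar{\mathcal{I}}_c=\mathcal{I}\setminus\mathcal{I}_c$. $\text{LP}_{\text{CKP}}$ is the linear program: maximize $\sum_{i\in\mathcal{I}}p_ix_i$ subject to $\sum_{i\in\mathcal{I}}w_ix_i\le b$; $\sum_{i\in\mathcal{I}_c}x_i-\sum_{i\in\bar{\mathcal{I}}_c}x_i\le 1$ for all $c\in\mathcal{C}$; and $0\le x_i\le 1$ for all $i\in\mathcal{I}$. Given a solution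 $\boldsymbol{x}\in[0,1]^n$ of $\text{LP}_{\text{CKP}}$, a color $c$ is dominant if $c\in\arg\max_{c'\in\mathcal{C}}\sum_{i\in\mathcal{I}_{c'}}x_i$; a dominant color $c$ is critical if moreover $\sum_{i\in\mathcal{I}_c}x_i-\sum_{i\in\bar{\mathcal{I}}_c}x_i=1$. Running time is counted as the number of elementary operations (arithmetic operations and comparisons on numbers, at unit cost). *)

(* Defs.v *)
From mathcomp Require Import all_boot all_order all_algebra.

Set Implicit Arguments.
Unset Strict Implicit.
Unset Printing Implicit Defensive.

Import Order.TTheory GRing.Theory Num.Theory.
Local Open Scope ring_scope.

(** * The Colored Knapsack Problem and its linear relaxation *)

Record ckp (n m : nat) := Ckp {
  profit : 'I_n -> int;
  weight : 'I_n -> int;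
  capacity : int;
  color : 'I_n -> 'I_m;
  weight_gt0 : forall i, 0 < weight i;
  capacity_gt0 : 0 < capacity;
  capacity_lt : capacity < \sum_i weight i
}.

Section LinearPrograms.
Variables (R : realFieldType) (n m : nat) (I : ckp n m).
Implicit Types (x y : 'I_n -> R) (c : 'I_m).

Definition total_profit x : R := \sum_i (profit I i)%:~R * x i.

Definition in_unit_box x : Prop := forall i, 0 <= x i <= 1.

Definition within_capacity x : Prop :=
  \sum_i (weight I i)%:~R * x i <= (capacity I)%:~R.

Definition color_sum x c : R := \sum_(i | color I i == c) x i.

Definition color_excess x c : R :=
  color_sum x c - \sum_(i | color I i != c) x i.

Definition profit_maximal (feasible : ('I_n -> R) -> Prop) x : Prop :=
  feasible x /\ forall y, feasible y -> total_profit y <= total_profit x.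

Definition lp_ckp_feasible x : Prop :=
  [/\ within_capacity x, forall c, color_excess x c <= 1 & in_unit_box x].

Definition dominant x c : Prop := forall c', color_sum x c' <= color_sum x c.

Definition critical x c : Prop := dominant x c /\ color_excess x c = 1.

Definition color_sign c (i : 'I_n) : R := if color I i == c then 1 else -1.

Definition critical_lp_feasible c x : Prop :=
  [/\ within_capacity x, \sum_i color_sign c i * x i = 1 & in_unit_box x].

End LinearPrograms.

(** * Model of computation

   A first-order functional language with recursion, whose values are built
   from numbers and immutable cons cells.  A program is a finite syntactic
   object, independent of the size of its input.  Every evaluation step (an
   arithmetic operation, a comparison, but also a variable access, a binding,
   the construction or inspection of a cell, a function call) costs one unit,
   so the cost bounds in particular the number of arithmetic operations and
   comparisons.  Only field operations and order comparisons are available on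
   numbers: there is no rounding, and literals are integers.                 *)

Inductive arith_op := Add | Sub | Mul | Div.

(* Variables are de Bruijn indices. *)
Inductive expr :=
| EVar of nat
| ENum of int
| EArith of arith_op & expr & expr
| EIfLe of expr & expr & expr & expr  (* if e1 <= e2 then e3 else e4 *)
| ELet of expr & expr                 (* e2 sees the value of e1 as variable 0 *)
| ENil
| ECons of expr & expr
| EMatch of expr & expr & expr        (* in the cons branch e3, variables 0 and
                                         1 are the head and the tail *)
| ECall of nat & expr.

(* [functions] are mutually recursive; each body, as well as [main], sees its
   single argument as variable 0. *)
Record program := Program { functions : seq expr; main : expr }.

Section Semantics.
Variable R : realFieldType.

Inductive value :=
| VNum of R
| VNil
| VCons of value & value.

Definition arith (o : arith_op) (a b : R) : option R :=
  match o with
  | Add => Some (a + b)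
  | Sub => Some (a - b)
  | Mul => Some (a * b)
  | Div => if b == 0 then None else Some (a / b)
  end.

(* [eval fs env e v k]: in the environment [env], the expression [e]
   evaluates to [v] in exactly [k] steps. *)
Inductive eval (fs : seq expr) : seq value -> expr -> value -> nat -> Prop :=
| eval_var env i v :
    onth env i = Some v ->
    eval fs env (EVar i) v 1
| eval_num env z :
    eval fs env (ENum z) (VNum z%:~R) 1
| eval_arith env o e1 e2 a b r k1 k2 :
    eval fs env e1 (VNum a) k1 -> eval fs env e2 (VNum b) k2 ->
    arith o a b = Some r ->
    eval fs env (EArith o e1 e2) (VNum r) (k1 + k2).+1
| eval_ifle env e1 e2 e3 e4 a b v k1 k2 k3 :
    eval fs env e1 (VNum a) k1 -> eval fs env e2 (VNum b) k2 ->
    eval fs env (if a <= b then e3 else e4) v k3 ->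
    eval fs env (EIfLe e1 e2 e3 e4) v (k1 + k2 + k3).+1
| eval_let env e1 e2 u v k1 k2 :
    eval fs env e1 u k1 -> eval fs (u :: env) e2 v k2 ->
    eval fs env (ELet e1 e2) v (k1 + k2).+1
| eval_nil env :
    eval fs env ENil VNil 1
| eval_cons env e1 e2 u v k1 k2 :
    eval fs env e1 u k1 -> eval fs env e2 v k2 ->
    eval fs env (ECons e1 e2) (VCons u v) (k1 + k2).+1
| eval_match_nil env e1 e2 e3 v k1 k2 :
    eval fs env e1 VNil k1 -> eval fs env e2 v k2 ->
    eval fs env (EMatch e1 e2 e3) v (k1 + k2).+1
| eval_match_cons env e1 e2 e3 h t v k1 k2 :
    eval fs env e1 (VCons h t) k1 -> eval fs [:: h, t & env] e3 v k2 ->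
    eval fs env (EMatch e1 e2 e3) v (k1 + k2).+1
| eval_call env f e body u v k1 k2 :
    eval fs env e u k1 -> onth fs f = Some body ->
    eval fs [:: u] body v k2 ->
    eval fs env (ECall f e) v (k1 + k2).+1.

Definition runs (P : program) (input output : value) (time : nat) : Prop :=
  eval (functions P) [:: input] (main P) output time.

(* Results and running times are unique. *)
Lemma eval_det fs env e v k v' k' :
  eval fs env e v k -> eval fs env e v' k' -> v = v' /\ k = k'.
Proof.
move=> ev; elim: ev v' k' => {env e v k}.
- by move=> env i v Hv v' k' E; inversion E; subst; split; congruence.
- by move=> env z v' k' E; inversion E.
- move=> env o e1 e2 a b r k1 k2 _ IH1 _ IH2 Hr v' k' E; inversion E; subst.
  have [[?] ?] := IH1 _ _ ltac:(eassumption); subst.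
  have [[?] ?] := IH2 _ _ ltac:(eassumption); subst.
  by split; congruence.
- move=> env e1 e2 e3 e4 a b v k1 k2 k3 _ IH1 _ IH2 _ IH3 v' k' E.
  inversion E; subst.
  have [[?] ?] := IH1 _ _ ltac:(eassumption); subst.
  have [[?] ?] := IH2 _ _ ltac:(eassumption); subst.
  by have [? ?] := IH3 _ _ ltac:(eassumption); subst.
- move=> env e1 e2 u v k1 k2 _ IH1 _ IH2 v' k' E; inversion E; subst.
  have [? ?] := IH1 _ _ ltac:(eassumption); subst.
  by have [? ?] := IH2 _ _ ltac:(eassumption); subst.
- by move=> env v' k' E; inversion E.
- move=> env e1 e2 u v k1 k2 _ IH1 _ IH2 v' k' E; inversion E; subst.
  have [? ?] := IH1 _ _ ltac:(eassumption); subst.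
  by have [? ?] := IH2 _ _ ltac:(eassumption); subst.
- move=> env e1 e2 e3 v k1 k2 _ IH1 _ IH2 v' k' E; inversion E; subst;
    have [// ? ?] := IH1 _ _ ltac:(eassumption); subst.
  by have [? ?] := IH2 _ _ ltac:(eassumption); subst.
- move=> env e1 e2 e3 h t v k1 k2 _ IH1 _ IH2 v' k' E; inversion E; subst;
    have [// [? ?] ?] := IH1 _ _ ltac:(eassumption); subst.
  by have [? ?] := IH2 _ _ ltac:(eassumption); subst.
- move=> env f e body u v k1 k2 _ IH1 Hf _ IH2 v' k' E; inversion E; subst.
  have [? ?] := IH1 _ _ ltac:(eassumption); subst.
  have ? : body0 = body by congruence.
  subst; by have [? ?] := IH2 _ _ ltac:(eassumption); subst.
Qed.

Definition vlist (s : seq value) : value := foldr VCons VNil s.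

Definition vnat (k : nat) : value := VNum k%:R.
Definition vint (z : int) : value := VNum z%:~R.

(* Colors are passed by their index; [m] is the number of colors. *)
Definition encode_input n m (I : ckp n m) (c : 'I_m) : value :=
  vlist [:: vnat n; vnat m; vint (capacity I); vnat c;
    vlist [seq vlist [:: vint (profit I i); vint (weight I i);
                         vnat (color I i)] | i <- enum 'I_n]].

Definition encode_solution n (x : 'I_n -> R) : value :=
  vlist [seq VNum (x i) | i <- enum 'I_n].

End Semantics.

Arguments VNil {R}.

(* Main.v *)
Require Import Defs.
From mathcomp Require Import all_boot all_order all_algebra.
From mathcomp Require Import zify ring lra.

Set Implicit Arguments.
Unset Strict Implicit.
Unset Printing Implicit Defensive.

Import Order.TTheory GRing.Theory Num.Theory.
Local Open Scope ring_scope.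

(** Attach a price l to the capacity and a price m to the excess of the
    critical color.  An optimal solution takes the items whose reduced profit
    p - l w - m g is positive at the optimal prices and omits those for which
    it is negative.  In the plane of prices, an item is a line, and what matters
    is on which side of it the optimal prices lie.  As the coefficients g are
    nonzero, no line is vertical, and Megiddo's prune-and-search in the plane
    applies.

    To locate the optimal prices with respect to a line of the plane, fix one
    price.  There remains a problem with a single constraint, which weighted
    selection of the breakpoints solves in linear time.  Solve it twice, once
    breaking ties in favor of a large value of the other constraint and once in
    favor of a small one.  If the prescribed value lies outside of the interval
    between the two, then the side of the optimal prices is known
    ([side_of_best]); otherwise a convex combination of the two solutions is
    optimal for the whole problem ([optimal_mix]).

    A round ([ev_round]) shears the plane so that the median slope becomes zero
    and crosses falling lines with rising ones.  This gives at least n / 2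
    candidate points, counting one point for each horizontal line.  Tests at the
    median of their first coordinates and then at the median of the second
    coordinates of the remaining ones confine the optimal prices to a quadrant
    which is opposite to n / 8 candidates.  Out of the two lines through such a
    candidate, one avoids the quadrant, so that its item is decided
    ([decided_value], [count_candidates]).  Hence the rounds cost a geometric
    series ([ev_solve]).  The medians come from selection with medians of nine
    ([ev_select]).

    This solves the problem with two equations.  For the capacity, take first
    the lightest solution among those that are optimal without it.  If it is too
    heavy, then the optimal price of the capacity is not zero, and the capacity
    is exhausted ([ev_main]).  That optimal prices exist follows from the
    existence of an optimal solution by a theorem of alternatives
    ([optimal_prices]).  An optimal solution exists by hypothesis: when the
    excess of one color is 1, the constraints of the others hold
    ([critical_lp_feasible_ckp]), so the given optimum of the larger program is
    one of the smaller program as well.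

    There are no arrays, so a solution has to be produced in the order of the
    items.  This works because the value of an item is a function of its data
    and of a bounded number of parameters within each round, and the decisions
    of a round are merged with the solution for the undecided items in a pass
    over the list ([ev_merge]). *)

(** * Writing programs with named variables *)

(** An expression is represented as a function of the number of variables in
    scope, so that binders of the host language can stand for de Bruijn
    variables: a variable is known by its level, which does not change when
    the scope grows, and its index is computed where it is used. *)
Definition code := nat -> expr.

Definition bound (level : nat) : code := fun d => EVar (d - level.+1).
Definition lit (z : int) : code := fun=> ENum z.
Arguments lit z%_Z.
Definition arith_code o (a b : code) : code := fun d => EArith o (a d) (b d).
Definition if_le (a b yes no : code) : code :=
  fun d => EIfLe (a d) (b d) (yes d) (no d).
Definition nil_code : code := fun=> ENil.
Definition cons_code (a b : code) : code := fun d => ECons (a d) (b d).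
Definition call f (a : code) : code := fun d => ECall f (a d).
Definition let_code (a : code) (b : code -> code) : code :=
  fun d => ELet (a d) (b (bound d) d.+1).
Definition match_code (a no : code) (yes : code -> code -> code) : code :=
  fun d => EMatch (a d) (no d) (yes (bound d.+1) (bound d) d.+2).
Definition fst_code (a : code) : code := match_code a nil_code (fun h _ => h).
Definition snd_code (a : code) : code := match_code a nil_code (fun _ t => t).
Definition fn (body : code -> code) : expr := body (bound 0) 1.

Declare Scope code_scope.
Delimit Scope code_scope with code.
Bind Scope code_scope with code.
Notation "a + b" := (arith_code Defs.Add a b) : code_scope.
Notation "a - b" := (arith_code Defs.Sub a b) : code_scope.
Notation "a * b" := (arith_code Defs.Mul a b) : code_scope.
Notation "a / b" := (arith_code Defs.Div a b) : code_scope.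
Notation "a :: b" := (cons_code a b) : code_scope.
Notation "a .1" := (fst_code a) : code_scope.
Notation "a .2" := (snd_code a) : code_scope.
Notation "# z" := (lit z) (at level 1, format "# z") : code_scope.
Notation "'If' a <= b 'Then' c 'Else' d" := (if_le a b c d)
  (at level 200, a at level 69, b at level 69, right associativity,
   format "'[hv' 'If'  a  <=  b '/'  'Then'  c '/'  'Else'  d ']'") : code_scope.
Notation "'Let' x := a 'In' b" := (let_code a (fun x => b))
  (at level 200, x name, right associativity,
   format "'[v' 'Let'  x  :=  a  'In' '/' b ']'") : code_scope.
Notation "'Match' a 'Empty' b 'Cell' x y 'To' c" :=
  (match_code a b (fun x y => c))
  (at level 200, x name, y name, right associativity) : code_scope.

Section Timing.
Variables (R : realFieldType) (fs : seq expr).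
Implicit Types (env : seq (value R)) (u v : value R) (n k r : nat).

(** Time bounds are kept in the form k (n + 1) + r, where n bounds the lengths
    of the lists being processed and r is the time of recursive calls.  In this
    form, the bound of an expression is found by adding up those of its parts,
    whatever n is. *)
Definition ev n env (c : code) v k r : Prop :=
  exists2 t, eval fs env (c (size env)) v t & (t <= k * n.+1 + r)%N.

Lemma ev_sum n k1 k2 r1 r2 t1 t2 :
  (t1 <= k1 * n.+1 + r1 -> t2 <= k2 * n.+1 + r2 ->
   (t1 + t2).+1 <= (k1 + k2).+1 * n.+1 + (r1 + r2))%N.
Proof. by lia. Qed.

Lemma ev_bound n env l v :
  onth env (size env - l.+1) = Some v -> ev n env (bound l) v 1 0.
Proof. by move=> h; exists 1%N; [exact: eval_var | lia]. Qed.

Lemma ev_lit n env z : ev n env (lit z) (VNum z%:~R) 1 0.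
Proof. by exists 1%N; [exact: eval_num | lia]. Qed.

Lemma ev_lit0 n env : ev n env (lit 0) (VNum 0) 1 0.
Proof. exact: ev_lit. Qed.

Lemma ev_lit1 n env : ev n env (lit 1) (VNum 1) 1 0.
Proof. exact: ev_lit. Qed.

Lemma ev_lit2 n env : ev n env (lit 2) (VNum 2%:R) 1 0.
Proof. exact: ev_lit. Qed.

Lemma ev_arith n env o c1 c2 a b x k1 k2 r1 r2 :
  ev n env c1 (VNum a) k1 r1 -> ev n env c2 (VNum b) k2 r2 ->
  arith o a b = Some x ->
  ev n env (arith_code o c1 c2) (VNum x) (k1 + k2).+1 (r1 + r2).
Proof.
move=> [t1 e1 h1] [t2 e2 h2] e; exists (t1 + t2).+1; last exact: ev_sum.
exact: eval_arith e1 e2 e.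
Qed.

Lemma ev_add n env c1 c2 a b k1 k2 r1 r2 :
  ev n env c1 (VNum a) k1 r1 -> ev n env c2 (VNum b) k2 r2 ->
  ev n env (c1 + c2)%code (VNum (a + b)) (k1 + k2).+1 (r1 + r2).
Proof. by move=> h1 h2; apply: ev_arith h1 h2 _. Qed.

Lemma ev_sub n env c1 c2 a b k1 k2 r1 r2 :
  ev n env c1 (VNum a) k1 r1 -> ev n env c2 (VNum b) k2 r2 ->
  ev n env (c1 - c2)%code (VNum (a - b)) (k1 + k2).+1 (r1 + r2).
Proof. by move=> h1 h2; apply: ev_arith h1 h2 _. Qed.

Lemma ev_mul n env c1 c2 a b k1 k2 r1 r2 :
  ev n env c1 (VNum a) k1 r1 -> ev n env c2 (VNum b) k2 r2 ->
  ev n env (c1 * c2)%code (VNum (a * b)) (k1 + k2).+1 (r1 + r2).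
Proof. by move=> h1 h2; apply: ev_arith h1 h2 _. Qed.

Lemma ev_div n env c1 c2 a b k1 k2 r1 r2 :
  ev n env c1 (VNum a) k1 r1 -> ev n env c2 (VNum b) k2 r2 -> b != 0 ->
  ev n env (c1 / c2)%code (VNum (a / b)) (k1 + k2).+1 (r1 + r2).
Proof. by move=> h1 h2 b0; apply: ev_arith h1 h2 _; rewrite /= (negbTE b0). Qed.

Lemma ev_nil n env : ev n env nil_code VNil 1 0.
Proof. by exists 1%N; [exact: eval_nil | lia]. Qed.

Lemma ev_cons n env c1 c2 u v k1 k2 r1 r2 :
  ev n env c1 u k1 r1 -> ev n env c2 v k2 r2 ->
  ev n env (c1 :: c2)%code (VCons u v) (k1 + k2).+1 (r1 + r2).
Proof.
move=> [t1 e1 h1] [t2 e2 h2]; exists (t1 + t2).+1; last exact: ev_sum.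
exact: eval_cons e1 e2.
Qed.

Lemma ev_let n env c1 c2 u v k1 k2 r1 r2 :
  ev n env c1 u k1 r1 ->
  ev n (u :: env) (c2 (bound (size env))) v k2 r2 ->
  ev n env (let_code c1 c2) v (k1 + k2).+1 (r1 + r2).
Proof.
move=> [t1 e1 h1] [t2 e2 h2]; exists (t1 + t2).+1; last exact: ev_sum.
exact: eval_let e1 e2.
Qed.

Lemma ev_match_nil n env c1 c2 c3 v k1 k2 r1 r2 :
  ev n env c1 VNil k1 r1 -> ev n env c2 v k2 r2 ->
  ev n env (match_code c1 c2 c3) v (k1 + k2).+1 (r1 + r2).
Proof.
move=> [t1 e1 h1] [t2 e2 h2]; exists (t1 + t2).+1; last exact: ev_sum.
exact: eval_match_nil e1 e2.
Qed.

Lemma ev_match_cons n env c1 c2 c3 h t v k1 k2 r1 r2 :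
  ev n env c1 (VCons h t) k1 r1 ->
  ev n [:: h, t & env] (c3 (bound (size env).+1) (bound (size env))) v k2 r2 ->
  ev n env (match_code c1 c2 c3) v (k1 + k2).+1 (r1 + r2).
Proof.
move=> [t1 e1 h1] [t2 e2 h2]; exists (t1 + t2).+1; last exact: ev_sum.
exact: eval_match_cons e1 e2.
Qed.

Lemma ev_fst n env c u v k r :
  ev n env c (VCons u v) k r -> ev n env c.1%code u k.+2 r.
Proof.
move=> h; rewrite -[r]addn0 -[k.+1]addn1; apply: ev_match_cons h _.
by apply: ev_bound; rewrite /= subnn.
Qed.

Lemma ev_snd n env c u v k r :
  ev n env c (VCons u v) k r -> ev n env c.2%code v k.+2 r.
Proof.
move=> h; rewrite -[r]addn0 -[k.+1]addn1; apply: ev_match_cons h _.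
by apply: ev_bound; rewrite /= subSS subSnn.
Qed.

Lemma ev_if n env a b c1 c2 c3 c4 v k1 k2 k3 r1 r2 r3 :
  ev n env c1 (VNum a) k1 r1 -> ev n env c2 (VNum b) k2 r2 ->
  ev n env (if a <= b then c3 else c4) v k3 r3 ->
  ev n env (if_le c1 c2 c3 c4) v (k1 + k2 + k3).+1 (r1 + r2 + r3).
Proof.
move=> [t1 e1 h1] [t2 e2 h2] [t3 e3 h3]; exists (t1 + t2 + t3).+1; last lia.
by apply: eval_ifle e1 e2 _; case: (a <= b) e3.
Qed.

(** Charging a conditional for both of its branches makes the bound
    independent of the outcome. *)
Lemma ev_if_both n env a b c1 c2 c3 c4 v k1 k2 k3 k4 r1 r2 r3 r4 :
  ev n env c1 (VNum a) k1 r1 -> ev n env c2 (VNum b) k2 r2 ->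
  (a <= b -> ev n env c3 v k3 r3) -> (b < a -> ev n env c4 v k4 r4) ->
  ev n env (if_le c1 c2 c3 c4) v (k1 + k2 + (k3 + k4)).+1
    (r1 + r2 + (r3 + r4)).
Proof.
move=> h1 h2 h3 h4; apply: (ev_if h1 h2).
by case: leP => [/h3|/h4] [t e h]; exists t => //; lia.
Qed.

Lemma ev_if_num n env a b c1 c2 c3 c4 (x y : R) k1 k2 k3 k4 r1 r2 r3 r4 :
  ev n env c1 (VNum a) k1 r1 -> ev n env c2 (VNum b) k2 r2 ->
  (a <= b -> ev n env c3 (VNum x) k3 r3) ->
  (b < a -> ev n env c4 (VNum y) k4 r4) ->
  ev n env (if_le c1 c2 c3 c4) (VNum (if a <= b then x else y))
    (k1 + k2 + (k3 + k4)).+1 (r1 + r2 + (r3 + r4)).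
Proof.
move=> h1 h2 h3 h4; apply: (ev_if_both h1 h2) => [h|].
  by rewrite h; exact: h3.
by rewrite ltNge => h; rewrite (negbTE h); apply: h4; rewrite ltNge.
Qed.

Lemma ev_call n env f body c u v k1 k2 r1 r2 :
  onth fs f = Some body ->
  ev n env c u k1 r1 -> ev n [:: u] (fun=> body) v k2 r2 ->
  ev n env (call f c) v (k1 + k2).+1 (r1 + r2).
Proof.
move=> ef [t1 e1 h1] [t2 e2 h2]; exists (t1 + t2).+1; last exact: ev_sum.
exact: eval_call e1 ef e2.
Qed.

Lemma ev_fn n body u v k r :
  ev n [:: u] (body (bound 0)) v k r -> ev n [:: u] (fun=> fn body) v k r.
Proof. by []. Qed.

Lemma ev_leq n n' k k' r r' env c v : (n <= n')%N -> (k <= k')%N ->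
  (r <= r')%N -> ev n env c v k r -> ev n' env c v k' r'.
Proof.
move=> hn hk hr [t e h]; exists t => //; apply: leq_trans h _.
by apply: leq_add => //; apply: leq_mul.
Qed.

Lemma ev_eq n k r env c v v' : ev n env c v k r -> v = v' ->
  ev n env c v' k r.
Proof. by move=> h <-. Qed.

(** * Passes over a list *)

(** The body of a function number [self] whose argument is a parameter
    followed by a list, and which folds [step] over that list from the right. *)
Definition fold_fn (self : nat) (start : code -> code)
    (step : code -> code -> code -> code) : expr :=
  fn (fun arg =>
    Match arg.2
    Empty start arg.1
    Cell x l To Let acc := call self (arg.1 :: l) In step arg.1 x acc)%code.

(** Instead of a function that is folded, the lemma takes the results [res] on
    all lists, so that filters, maps and sums need no conversion. *)
Lemma ev_fold (A : Type) (P : pred A) (enc : A -> value R)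
    (res : seq A -> value R) self start step par k0 k1 :
  onth fs self = Some (fold_fn self start step) ->
  (forall l, ev 0 [:: VCons par l] (start (bound 0).1%code) (res [::]) k0 0) ->
  (forall x l t t', P x -> ev 0 [:: res l; enc x; t; VCons par t']
     (step (bound 0).1%code (bound 2) (bound 3)) (res (x :: l)) k1 0) ->
  forall l, all P l -> ev (size l) [:: VCons par (vlist (map enc l))]
    (fun=> fold_fn self start step) (res l) (k0 + k1 + 20) 0.
Proof.
move=> hself hstart hstep; elim=> [_|x l IH /=/andP[Px /IH{}IH]].
  apply: (ev_leq (leqnn _) _ _); last first.
  - apply: ev_fn; apply: ev_match_nil; last exact: hstart.
    by apply: (ev_snd (u := par)); apply: ev_bound.
  - by [].
  - by lia.
have [t2 e2 h2] := IH.
have hc : ev 0 [:: enc x; vlist (map enc l);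
      VCons par (vlist (map enc (x :: l)))]
   (Let acc := call self ((bound 0).1 :: bound 1) In
      step (bound 0).1 (bound 2) acc)%code (res (x :: l)) (k1 + 8) t2.
  apply: (ev_leq (leqnn _) _ _); last first.
  - apply: ev_let; last exact: hstep Px.
    apply: (ev_call (r2 := t2) (k2 := 0)) hself _ _.
      apply: ev_cons; first by apply: (ev_fst); apply: ev_bound.
      by apply: ev_bound.
    by exists t2 => //; lia.
  - by lia.
  - by lia.
have [t e h] : ev 0 [:: VCons par (vlist (map enc (x :: l)))]
    (fun=> fold_fn self start step) (res (x :: l)) (k1 + 12) t2.
  apply: (ev_leq (leqnn _) _ _); last first.
  - apply: ev_fn; apply: ev_match_cons; last exact: hc.
    by apply: (ev_snd (u := par)); apply: ev_bound.
  - by lia.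
  - by lia.
by exists t => //=; move: h h2; rewrite /=; lia.
Qed.

End Timing.

(** * The program *)

(** A function is called by its position in the list [fns]. *)
Definition f_thirds := 0%N.
Definition f_total := 1%N.
Definition f_above := 2%N.
Definition f_below := 3%N.
Definition f_select := 4%N.
Definition f_median := 5%N.
Definition f_breaks := 6%N.
Definition f_deficit := 7%N.
Definition f_multiplier := 8%N.
Definition f_tied := 9%N.
Definition f_filled := 10%N.
Definition f_assign := 11%N.
Definition f_lexopt := 12%N.
Definition f_zip := 13%N.
Definition f_dot := 14%N.
Definition f_negate := 15%N.
Definition f_mix := 16%N.
Definition f_test := 17%N.
Definition f_slopes := 18%N.
Definition f_shear := 19%N.
Definition f_falling := 20%N.
Definition f_rising := 21%N.
Definition f_level := 22%N.
Definition f_crossings := 23%N.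
Definition f_firsts := 24%N.
Definition f_seconds := 25%N.
Definition f_beyond := 26%N.
Definition f_price_u := 27%N.
Definition f_price_v := 28%N.
Definition f_undecided := 29%N.
Definition f_fixed_u := 30%N.
Definition f_fixed_v := 31%N.
Definition f_merge := 32%N.
Definition f_solve := 33%N.
Definition f_parse := 34%N.

Notation NIL := nil_code.

Section Program.
Local Open Scope code_scope.

Definition keep_nil (par : code) : code := NIL.
Definition zero (par : code) : code := #0.

Definition med3_code (a b c : code) : code :=
  If a <= b
  Then If b <= c Then b Else If a <= c Then c Else a
  Else If a <= c Then a Else If b <= c Then c Else b.

(** Points carry a position and a weight; the medians get weight 1. *)
Definition thirds_fn : expr := fn (fun l =>
  Match l Empty NIL Cell x l1 To
  Match l1 Empty (x.1 :: #1) :: NIL Cell y l2 To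
  Match l2 Empty (x.1 :: #1) :: NIL Cell z l3 To
  (med3_code x.1 y.1 z.1 :: #1) :: call f_thirds l3).

Definition total_fn := fold_fn f_total zero (fun par x acc => x.2 + acc).

Definition above_fn := fold_fn f_above keep_nil (fun t x acc =>
  If x.1 <= t Then acc Else x :: acc).

Definition below_fn := fold_fn f_below keep_nil (fun t x acc =>
  If t <= x.1 Then acc Else x :: acc).

(** Medians of three, taken twice, leave a ninth of the points; their median is
    below, and above, at least 2 / 9 of all points up to a constant. *)
Definition select_fn : expr := fn (fun arg =>
  Match arg.2 Empty #0 Cell x l To
  Match l Empty x.1 Cell y l' To
  Let ms := call f_thirds (call f_thirds arg.2) In
  Let t := call f_select (call f_total (NIL :: ms) / #2 :: ms) In
  Let hi := call f_above (t :: arg.2) In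
  If call f_total (NIL :: hi) <= arg.1
  Then
    Let lo := call f_below (t :: arg.2) In
    Let rest := arg.1 - (call f_total (NIL :: arg.2) - call f_total (NIL :: lo)) In
    If rest <= #0 Then t Else call f_select (rest :: lo)
  Else call f_select (arg.1 :: hi)).

Definition median_fn : expr := fn (fun l =>
  call f_select (call f_total (NIL :: l) / #2 :: l)).

(** Items carry a profit and the coefficients of two constraints. With one of
    them ignored, let the price t of the other one decrease: an item with
    coefficient a > 0 enters the optimal solution when t passes p / a, and one
    with a < 0 leaves it.  Either way the sum of a x grows by the absolute value
    of a, starting from the sum of the negative coefficients. *)
Definition breaks_fn := fold_fn f_breaks keep_nil (fun par x acc =>
  If x.2.1 <= #0
  Then If #0 <= x.2.1 Then acc Else (x.1 / x.2.1 :: #0 - x.2.1) :: acc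
  Else (x.1 / x.2.1 :: x.2.1) :: acc).

Definition deficit_fn := fold_fn f_deficit zero (fun par x acc =>
  If #0 <= x.2.1 Then acc Else #0 - x.2.1 + acc).

Definition multiplier_fn : expr := fn (fun arg =>
  call f_select (arg.1 + call f_deficit (NIL :: arg.2)
                 :: call f_breaks (NIL :: arg.2))).

(** Among the tied items, the second objective replaces the first one. *)
Definition tied_fn := fold_fn f_tied keep_nil (fun t x acc =>
  Let r := x.1 - t * x.2.1 In
  If r <= #0
  Then If #0 <= r Then (x.2.2 :: x.2.1 :: x.2.2) :: acc Else acc
  Else acc).

Definition filled_fn := fold_fn f_filled zero (fun t x acc =>
  If x.1 - t * x.2.1 <= #0 Then acc Else x.2.1 + acc).

Definition assign_fn := fold_fn f_assign keep_nil (fun par x acc =>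
  Let r := x.1 - par.1 * x.2.1 In
  If r <= #0
  Then
    If #0 <= r
    Then
      Let r2 := x.2.2 - par.2.1 * x.2.1 In
      If r2 <= #0
      Then
        If #0 <= r2
        Then If x.2.1 <= #0 Then (#1 - par.2.2) :: acc Else par.2.2 :: acc
        Else #0 :: acc
      Else #1 :: acc
    Else #0 :: acc
  Else #1 :: acc).

(** The third component is the second objective.  Items that are tied in both
    objectives get the share [theta] or 1 - [theta], depending on the sign of
    their coefficient, which fills up the constraint. *)
Definition lexopt_fn : expr := fn (fun arg =>
  Let t := call f_multiplier arg In
  Let l1 := call f_tied (t :: arg.2) In
  Let S1 := arg.1 - call f_filled (t :: arg.2) In
  Let t2 := call f_multiplier (S1 :: l1) In
  Let l2 := call f_tied (t2 :: l1) In
  Let S2 := S1 - call f_filled (t2 :: l1) In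
  Let d := call f_total (NIL :: call f_breaks (NIL :: l2)) In
  Let theta := (If d <= #0 Then #0
                Else (S2 + call f_deficit (NIL :: l2)) / d) In
  call f_assign ((t :: t2 :: theta) :: arg.2)).

Definition zip_fn : expr := fn (fun arg =>
  Match arg.1 Empty NIL Cell x l To
  Match arg.2 Empty NIL Cell y l' To
  (x :: y) :: call f_zip (l :: l')).

Definition dot_fn := fold_fn f_dot zero (fun par x acc =>
  x.1.2.2 * x.2 + acc).

Definition negate_fn := fold_fn f_negate keep_nil (fun par x acc =>
  (x.1 :: x.2.1 :: #0 - x.2.2) :: acc).

Definition mix_fn := fold_fn f_mix keep_nil (fun theta x acc =>
  (theta * x.1 + (#1 - theta) * x.2) :: acc).

(** Besides the sign, which is 0 when the prescribed sum is attained, the result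
    contains a solution in that case. *)
Definition test_fn : expr := fn (fun arg =>
  Let x1 := call f_lexopt (arg.1.1 :: arg.2) In
  Let hi := call f_dot (NIL :: call f_zip (arg.2 :: x1)) In
  If arg.1.2 <= hi
  Then
    Let x2 := call f_lexopt (arg.1.1 :: call f_negate (NIL :: arg.2)) In
    Let lo := call f_dot (NIL :: call f_zip (arg.2 :: x2)) In
    If lo <= arg.1.2
    Then
      Let theta := (If hi <= lo Then #0 Else (arg.1.2 - lo) / (hi - lo)) In
      #0 :: call f_mix (theta :: call f_zip (x1 :: x2))
    Else (#0 - #1) :: NIL
  Else #1 :: NIL).

Definition slopes_fn := fold_fn f_slopes keep_nil (fun par x acc =>
  (x.2.1 / x.2.2 :: #1) :: acc).

Definition shear_fn := fold_fn f_shear keep_nil (fun m x acc =>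
  (x.1 :: x.2.1 - m * x.2.2 :: x.2.2) :: acc).

Definition falling_fn := fold_fn f_falling keep_nil (fun par x acc =>
  If #0 <= x.2.1 * x.2.2 Then acc Else x :: acc).

Definition rising_fn := fold_fn f_rising keep_nil (fun par x acc =>
  If x.2.1 * x.2.2 <= #0 Then acc Else x :: acc).

Definition level_fn := fold_fn f_level keep_nil (fun par x acc =>
  If x.2.1 <= #0
  Then If #0 <= x.2.1 Then (#0 :: x.1 / x.2.2) :: acc Else acc
  Else acc).

Definition crossings_fn := fold_fn f_crossings (fun par => par) (fun par x acc =>
  Let a := (x.1.1 / x.1.2.2 - x.2.1 / x.2.2.2) /
           (x.1.2.1 / x.1.2.2 - x.2.2.1 / x.2.2.2) In
  (a :: x.1.1 / x.1.2.2 - a * (x.1.2.1 / x.1.2.2)) :: acc).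

Definition firsts_fn := fold_fn f_firsts keep_nil (fun par x acc =>
  (x.1 :: #1) :: acc).

Definition seconds_fn := fold_fn f_seconds keep_nil (fun par x acc =>
  (x.2 :: #1) :: acc).

Definition beyond_fn := fold_fn f_beyond keep_nil (fun par x acc =>
  If #0 <= par.1 * (x.1 - par.2) Then x :: acc Else acc).

Definition price_u_fn := fold_fn f_price_u keep_nil (fun a x acc =>
  (x.1 - a * x.2.1 :: x.2.2 :: x.2.1) :: acc).

Definition price_v_fn := fold_fn f_price_v keep_nil (fun c x acc =>
  (x.1 - c * x.2.2 :: x.2.1 :: x.2.2) :: acc).

(** The quadrant [q] consists of its corner and of two signs. *)
Definition if_decided (q x yes no : code) : code :=
  If #0 <= (x.1 - q.1.1 * x.2.1 - q.1.2 * x.2.2) * (q.2.2 * x.2.2)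
  Then If #0 <= q.2.1 * x.2.1 * (q.2.2 * x.2.2) Then yes Else no
  Else no.

Definition undecided_fn := fold_fn f_undecided keep_nil (fun q x acc =>
  if_decided q x acc (x :: acc)).

Definition fixed_u_fn := fold_fn f_fixed_u zero (fun q x acc =>
  if_decided q x (If #0 <= q.2.2 * x.2.2 Then x.2.1 + acc Else acc) acc).

Definition fixed_v_fn := fold_fn f_fixed_v zero (fun q x acc =>
  if_decided q x (If #0 <= q.2.2 * x.2.2 Then x.2.2 + acc Else acc) acc).

(** The last component lists the values of the undecided items only. *)
Definition merge_fn : expr := fn (fun arg =>
  Match arg.2.1 Empty NIL Cell x l To
  if_decided arg.1 x
    ((If #0 <= arg.1.2.2 * x.2.2 Then #1 Else #0)
     :: call f_merge (arg.1 :: l :: arg.2.2))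
    (arg.2.2.1 :: call f_merge (arg.1 :: l :: arg.2.2.2))).

Definition solve_fn : expr := fn (fun arg =>
  Match arg.2 Empty NIL Cell x0 l0 To
  Let m := call f_median (call f_slopes (NIL :: arg.2)) In
  Let l := call f_shear (m :: arg.2) In
  Let U := arg.1.1 - m * arg.1.2 In
  Let V := arg.1.2 In
  Let pts := call f_crossings (call f_level (NIL :: l) ::
    call f_zip (call f_falling (NIL :: l) :: call f_rising (NIL :: l))) In
  Let a := call f_median (call f_firsts (NIL :: pts)) In
  Let test1 := call f_test ((V :: U) :: call f_price_u (a :: l)) In
  If test1.1 * test1.1 <= #0 Then test1.2 Else
  Let pts' := call f_beyond ((test1.1 :: a) :: pts) In
  Let c := call f_median (call f_seconds (NIL :: pts')) In
  Let test2 := call f_test ((U :: V) :: call f_price_v (c :: l)) In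
  If test2.1 * test2.1 <= #0 Then test2.2 Else
  Let q := (a :: c) :: test1.1 :: test2.1 In
  Let rest := call f_solve
    ((U - call f_fixed_u (q :: l) :: V - call f_fixed_v (q :: l))
     :: call f_undecided (q :: l)) In
  call f_merge (q :: l :: rest)).

Definition parse_fn := fold_fn f_parse keep_nil (fun c x acc =>
  If x.2.2.1 <= c
  Then If c <= x.2.2.1 Then (x.1 :: x.2.1 :: #1) :: acc
       Else (x.1 :: x.2.1 :: #0 - #1) :: acc
  Else (x.1 :: x.2.1 :: #0 - #1) :: acc).

(** With the capacity coefficient negated as a second objective, [x] is the
    lightest of the solutions that are optimal without capacity. *)
Definition main_code : expr := fn (fun arg =>
  Let l := call f_parse (arg.2.2.2.1 :: arg.2.2.2.2.1) In
  Let free := call f_price_u (#0 :: l) In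
  Let x := call f_lexopt (#1 :: call f_negate (NIL :: free)) In
  If call f_dot (NIL :: call f_zip (free :: x)) <= arg.2.2.1
  Then x Else call f_solve ((arg.2.2.1 :: #1) :: l)).

Definition fns : seq expr := [:: thirds_fn; total_fn; above_fn; below_fn;
  select_fn; median_fn; breaks_fn; deficit_fn; multiplier_fn; tied_fn;
  filled_fn; assign_fn; lexopt_fn; zip_fn; dot_fn; negate_fn; mix_fn; test_fn;
  slopes_fn; shear_fn; falling_fn; rising_fn; level_fn; crossings_fn;
  firsts_fn; seconds_fn; beyond_fn; price_u_fn; price_v_fn; undecided_fn;
  fixed_u_fn; fixed_v_fn; merge_fn; solve_fn; parse_fn]%SEQ.

End Program.

(** * Evaluating the passes *)

Lemma size_filter_leq (T : Type) (a : pred T) (s : seq T) :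
  (size (filter a s) <= size s)%N.
Proof. by rewrite size_filter count_size. Qed.

Section Passes.
Variable R : realFieldType.
Implicit Types (n k r : nat) (env : seq (value R)).

Definition point (x : R * R) : value R := VCons (VNum x.1) (VNum x.2).
Definition points (l : seq (R * R)) : value R := vlist (map point l).
Definition item (x y z : R) : value R := VCons (VNum x) (VCons (VNum y) (VNum z)).
Definition items (T : Type) (x y z : T -> R) (s : seq T) : value R :=
  vlist [seq item (x i) (y i) (z i) | i <- s].
Definition nums (l : seq R) : value R := vlist (map (@VNum R) l).

(** A round number above the time of any step of the passes below. *)
Definition step_time := 300%N.
Definition pass_time := (step_time + step_time + 20)%N.

Notation ev := (ev fns).

Lemma ev_time n env c (v : value R) k r :
  ev n env c v k r -> r = 0%N -> (k <= step_time)%N -> ev n env c v step_time 0.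
Proof. by move=> h r0 hk; apply: ev_leq h => //; rewrite r0. Qed.

(** One more step of a recursion that spends [t] in the recursive call. *)
Lemma ev_rec n env c (v : value R) t :
  (t <= pass_time * n.+1 + 0)%N -> ev 0 env c v step_time t ->
  ev n.+1 env c v pass_time 0.
Proof. by move=> ht [t' e h]; exists t' => //; rewrite /pass_time in ht *; lia. Qed.

Lemma ev_flat n env c (v : value R) k r :
  ev n env c v k r -> ev 0 env c v 0 (k * n.+1 + r).
Proof. by move=> [t e h]; exists t => //; lia. Qed.

Lemma ev_widen n env c (v : value R) r : ev 0 env c v 0 r -> ev n env c v 0 r.
Proof. by move=> h; apply: ev_leq h. Qed.

Lemma ev_own n env c (v : value R) k r : ev n env c v k r ->
  exists2 t, (t <= k * n.+1 + r)%N & ev 0 env c v 0 t.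
Proof. by move=> [t e h]; exists t => //; exists t => //; lia. Qed.

Lemma ev_time_r n env c (v : value R) k r t :
  ev n env c v k r -> r = t -> (k <= step_time)%N -> ev n env c v step_time t.
Proof. by move=> h <- hk; apply: ev_leq h. Qed.

Lemma ev_use n m env f body c (u v : value R) k K r :
  onth fns f = Some body -> (m <= n)%N ->
  ev m [:: u] (fun=> body) v K 0 -> ev n env c u k r ->
  ev n env (call f c) v (k + K).+1 (r + 0).
Proof.
move=> ef hmn h hc; apply: ev_call ef hc _.
exact: ev_leq (leqnn _) (leqnn _) h.
Qed.

Lemma ev_pass (A : Type) (enc : A -> value R) (res : seq A -> value R)
    self start step par :
  onth fns self = Some (fold_fn self start step) ->
  (forall l, ev 0 [:: VCons par l] (start (bound 0).1%code)
     (res [::]) step_time 0) ->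
  (forall x l t t', ev 0 [:: res l; enc x; t; VCons par t']
     (step (bound 0).1%code (bound 2) (bound 3)) (res (x :: l)) step_time 0) ->
  forall l, ev (size l) [:: VCons par (vlist (map enc l))]
    (fun=> fold_fn self start step) (res l) pass_time 0.
Proof.
move=> h1 h2 h3 l; apply: (ev_fold (P := predT) h1 h2 _ (all_predT l)).
by move=> x l' t t' _; exact: h3.
Qed.

End Passes.


Ltac ev1 := first
  [ eapply ev_bound; reflexivity | eapply ev_fst | eapply ev_snd
  | eapply ev_add | eapply ev_sub | eapply ev_mul | eapply ev_div
  | eapply ev_lit0 | eapply ev_lit1 | eapply ev_lit2
  | eapply ev_nil | eapply ev_cons | eapply ev_let ].
Ltac evs := repeat ev1.
(** Symbolic evaluation towards a known value; the equations between values
    remain as goals. *)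
Ltac evc := lazymatch goal with
  | |- ev _ _ _ (if_le _ _ _ _) _ _ _ =>
      eapply ev_if_both; [evs | evs | move=> ?; evc | move=> ?; evc]
  | |- ev _ _ _ (if_decided _ _ _ _) _ _ _ => rewrite /if_decided; evc
  | |- ev _ _ _ (let_code _ _) _ _ _ => eapply ev_let; [evs | cbv beta; evc]
  | |- _ => eapply ev_eq; [evs | ]
  end.
Ltac pass := eapply ev_time; [evc | | ].

Section PassLemmas.
Variables (R : realFieldType).
Notation ev := (ev fns).
Implicit Types (l : seq (R * R)).

Lemma ev_total l :
  ev (size l) [:: VCons VNil (points l)] (fun=> total_fn)
    (VNum (\sum_(x <- l) x.2)) pass_time 0.
Proof.
apply: (ev_pass (res := fun l => VNum (\sum_(x <- l) x.2))) => //.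
  by move=> l'; rewrite big_nil; pass.
by move=> x l' t t'; rewrite big_cons; pass.
Qed.

Lemma ev_above (t : R) l :
  ev (size l) [:: VCons (VNum t) (points l)] (fun=> above_fn)
    (points [seq x <- l | t < x.1]) pass_time 0.
Proof.
apply: (ev_pass (res := fun l => points [seq x <- l | t < x.1])) => //.
  by move=> l'; pass.
by move=> x l' w w' /=; pass => //; case: ifPn => // ?; exfalso; lra.
Qed.

Lemma ev_below (t : R) l :
  ev (size l) [:: VCons (VNum t) (points l)] (fun=> below_fn)
    (points [seq x <- l | x.1 < t]) pass_time 0.
Proof.
apply: (ev_pass (res := fun l => points [seq x <- l | x.1 < t])) => //.
  by move=> l'; pass.
by move=> x l' w w' /=; pass => //; case: ifPn => // ?; exfalso; lra.
Qed.

Lemma ev_firsts l :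
  ev (size l) [:: VCons VNil (points l)] (fun=> firsts_fn)
    (points [seq (x.1, 1) | x <- l]) pass_time 0.
Proof.
apply: (ev_pass (res := fun l => points [seq (x.1, 1) | x <- l])) => //.
  by move=> l'; pass.
by move=> x l' w w' /=; pass.
Qed.

Lemma ev_seconds l :
  ev (size l) [:: VCons VNil (points l)] (fun=> seconds_fn)
    (points [seq (x.2, 1) | x <- l]) pass_time 0.
Proof.
apply: (ev_pass (res := fun l => points [seq (x.2, 1) | x <- l])) => //.
  by move=> l'; pass.
by move=> x l' w w' /=; pass.
Qed.

Lemma ev_beyond (s a : R) l :
  ev (size l) [:: VCons (VCons (VNum s) (VNum a)) (points l)] (fun=> beyond_fn)
    (points [seq x <- l | 0 <= s * (x.1 - a)]) pass_time 0.
Proof.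
apply: (ev_pass (res := fun l => points [seq x <- l | 0 <= s * (x.1 - a)])) => //.
  by move=> l'; pass.
by move=> x l' w w' /=; pass => //; case: ifPn => // ?; exfalso; lra.
Qed.

Lemma ev_mix (T : Type) (th : R) (f g : T -> R) (s : seq T) :
  ev (size s) [:: VCons (VNum th)
      (vlist [seq VCons (VNum (f i)) (VNum (g i)) | i <- s])] (fun=> mix_fn)
    (nums [seq th * f i + (1 - th) * g i | i <- s]) pass_time 0.
Proof.
apply: (ev_pass (res := fun s => nums [seq th * f i + (1 - th) * g i | i <- s])) => //.
  by move=> l'; pass.
by move=> x l' w w' /=; pass.
Qed.

Variables (T : Type) (p u v : T -> R).
Implicit Types (s : seq T).

Lemma ev_dot (x : T -> R) s :
  ev (size s) [:: VCons VNil
      (vlist [seq VCons (item (p i) (u i) (v i)) (VNum (x i)) | i <- s])]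
    (fun=> dot_fn) (VNum (\sum_(i <- s) v i * x i)) pass_time 0.
Proof.
apply: (ev_pass (res := fun s => VNum (\sum_(i <- s) v i * x i))) => //.
  by move=> l'; rewrite big_nil; pass.
by move=> y l' t t'; rewrite big_cons; pass.
Qed.

Lemma ev_breaks s :
  ev (size s) [:: VCons VNil (items p u v s)] (fun=> breaks_fn)
    (points [seq (p i / u i, `|u i|) | i <- s & u i != 0]) pass_time 0.
Proof.
apply: (ev_pass (res := fun s =>
  points [seq (p i / u i, `|u i|) | i <- s & u i != 0])) => //.
  by move=> l'; pass.
move=> x l' t t' /=; pass => //.
- by have -> : u x = 0 by [lra]; rewrite eqxx.
- by lra.
- case: eqVneq => [e|_]; first by exfalso; lra.
  by congr (VCons (VCons _ (VNum _)) _); rewrite ltr0_norm //=; ring.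
- by lra.
- case: eqVneq => [e|_]; first by exfalso; lra.
  by rewrite /= gtr0_norm //; lra.
Qed.

Lemma ev_deficit s :
  ev (size s) [:: VCons VNil (items p u v s)] (fun=> deficit_fn)
    (VNum (\sum_(i <- s | u i < 0) - u i)) pass_time 0.
Proof.
apply: (ev_pass (res := fun s => VNum (\sum_(i <- s | u i < 0) - u i))) => //.
  by move=> l'; rewrite big_nil; pass.
move=> x l' t t' /=; rewrite big_cons; pass => //; case: ifPn => // ?; try by exfalso; lra.
by congr VNum; rewrite sub0r.
Qed.

Lemma ev_tied (t : R) s :
  ev (size s) [:: VCons (VNum t) (items p u v s)] (fun=> tied_fn)
    (items v u v [seq i <- s | p i - t * u i == 0]) pass_time 0.
Proof.
apply: (ev_pass (res := fun s =>
  items v u v [seq i <- s | p i - t * u i == 0])) => //.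
  by move=> l'; pass.
by move=> x l' w w' /=; pass => //; case: eqVneq => // ?; exfalso; lra.
Qed.

Lemma ev_filled (t : R) s :
  ev (size s) [:: VCons (VNum t) (items p u v s)] (fun=> filled_fn)
    (VNum (\sum_(i <- s | 0 < p i - t * u i) u i)) pass_time 0.
Proof.
apply: (ev_pass (res := fun s =>
  VNum (\sum_(i <- s | 0 < p i - t * u i) u i))) => //.
  by move=> l'; rewrite big_nil; pass.
by move=> x l' w w' /=; rewrite big_cons; pass => //; case: ifPn => // ?; exfalso; lra.
Qed.

Lemma ev_negate s :
  ev (size s) [:: VCons VNil (items p u v s)] (fun=> negate_fn)
    (items p u (fun i => - v i) s) pass_time 0.
Proof.
apply: (ev_pass (res := items p u (fun i => - v i))) => //.
  by move=> l'; pass.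
by move=> x l' w w' /=; pass => //=; rewrite sub0r.
Qed.

(** The value of an item in the lexicographic optimum with multipliers [t] for
    the first objective and [t2] for the second one. *)
Definition lex_value (t t2 th pi ai qi : R) : R :=
  if 0 < pi - t * ai then 1 else if pi - t * ai < 0 then 0 else
  if 0 < qi - t2 * ai then 1 else if qi - t2 * ai < 0 then 0 else
  if 0 < ai then th else 1 - th.

Lemma ev_assign (t t2 th : R) s :
  ev (size s) [:: VCons (VCons (VNum t) (VCons (VNum t2) (VNum th)))
      (items p u v s)] (fun=> assign_fn)
    (nums [seq lex_value t t2 th (p i) (u i) (v i) | i <- s]) pass_time 0.
Proof.
apply: (ev_pass (res := fun s =>
  nums [seq lex_value t t2 th (p i) (u i) (v i) | i <- s])) => //.
  by move=> l'; pass.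
move=> x l' w w'; pass => //; congr (VCons (VNum _) _); rewrite /lex_value.
all: by do ?[case: ifPn => ?]; rewrite //; exfalso; lra.
Qed.


Lemma ev_slopes s : (forall i, v i != 0) ->
  ev (size s) [:: VCons VNil (items p u v s)] (fun=> slopes_fn)
    (points [seq (u i / v i, 1) | i <- s]) pass_time 0.
Proof.
move=> v0; apply: (ev_pass (res := fun s =>
  points [seq (u i / v i, 1) | i <- s])) => //.
  by move=> l'; pass.
by move=> x l' w w' /=; pass.
Qed.

Lemma ev_shear (m : R) s :
  ev (size s) [:: VCons (VNum m) (items p u v s)] (fun=> shear_fn)
    (items p (fun i => u i - m * v i) v s) pass_time 0.
Proof.
apply: (ev_pass (res := items p (fun i => u i - m * v i) v)) => //.
  by move=> l'; pass.
by move=> x l' w w' /=; pass.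
Qed.

Lemma ev_price_u (a : R) s :
  ev (size s) [:: VCons (VNum a) (items p u v s)] (fun=> price_u_fn)
    (items (fun i => p i - a * u i) v u s) pass_time 0.
Proof.
apply: (ev_pass (res := items (fun i => p i - a * u i) v u)) => //.
  by move=> l'; pass.
by move=> x l' w w' /=; pass.
Qed.

Lemma ev_price_v (c : R) s :
  ev (size s) [:: VCons (VNum c) (items p u v s)] (fun=> price_v_fn)
    (items (fun i => p i - c * v i) u v s) pass_time 0.
Proof.
apply: (ev_pass (res := items (fun i => p i - c * v i) u v)) => //.
  by move=> l'; pass.
by move=> x l' w w' /=; pass.
Qed.

Lemma ev_falling s :
  ev (size s) [:: VCons VNil (items p u v s)] (fun=> falling_fn)
    (items p u v [seq i <- s | u i * v i < 0]) pass_time 0.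
Proof.
apply: (ev_pass (res := fun s => items p u v [seq i <- s | u i * v i < 0])) => //.
  by move=> l'; pass.
by move=> x l' w w' /=; pass => //; case: ifPn => // ?; exfalso; lra.
Qed.

Lemma ev_rising s :
  ev (size s) [:: VCons VNil (items p u v s)] (fun=> rising_fn)
    (items p u v [seq i <- s | 0 < u i * v i]) pass_time 0.
Proof.
apply: (ev_pass (res := fun s => items p u v [seq i <- s | 0 < u i * v i])) => //.
  by move=> l'; pass.
by move=> x l' w w' /=; pass => //; case: ifPn => // ?; exfalso; lra.
Qed.

Lemma ev_level s : (forall i, v i != 0) ->
  ev (size s) [:: VCons VNil (items p u v s)] (fun=> level_fn)
    (points [seq (0, p i / v i) | i <- s & u i == 0]) pass_time 0.
Proof.
move=> v0; apply: (ev_pass (res := fun s =>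
  points [seq (0, p i / v i) | i <- s & u i == 0])) => //.
  by move=> l'; pass.
by move=> x l' w w' /=; pass => //; case: eqVneq => // ?; exfalso; lra.
Qed.

(** The common point of the dual lines a u / v + c = p / v of two items. *)
Definition crossing (ij : T * T) : R * R :=
  let: (i, j) := ij in
  let a := (p i / v i - p j / v j) / (u i / v i - u j / v j) in
  (a, p i / v i - a * (u i / v i)).

Lemma ev_crossings l (s : seq (T * T)) : (forall i, v i != 0) ->
  all (fun ij => u ij.1 / v ij.1 != u ij.2 / v ij.2) s ->
  ev (size s) [:: VCons (points l) (vlist
      [seq VCons (item (p ij.1) (u ij.1) (v ij.1))
                 (item (p ij.2) (u ij.2) (v ij.2)) | ij <- s])]
    (fun=> crossings_fn)
    (points ([seq crossing ij | ij <- s] ++ l)) pass_time 0.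
Proof.
move=> v0 hs; apply: (ev_fold (self := f_crossings) (start := id)
  (enc := fun ij => VCons (item (p ij.1) (u ij.1) (v ij.1))
                          (item (p ij.2) (u ij.2) (v ij.2)))
  (res := fun z => points ([seq crossing ij | ij <- z] ++ l))
  (k0 := step_time) (k1 := step_time) _ _ _ hs) => //.
  by move=> l'; pass.
move=> [i j] l' w w' /= hij; have huv : u i / v i - u j / v j != 0.
  by rewrite subr_eq0.
by pass.
Qed.

Section Quadrant.
Variables (a c s1 s2 : R).

(** For prices l and m with s1 (a - l) > 0 and s2 (c - m) > 0, the reduced profit
    p - l u - m v is the sum of p - a u - c v, (a - l) u and (c - m) v.  The item
    is decided if none of these three terms has the sign opposite to that of
    s2 v, which is the sign of the third one. *)
Definition decided (i : T) : bool :=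
  (0 <= (p i - a * u i - c * v i) * (s2 * v i)) && (0 <= s1 * u i * (s2 * v i)).

Definition quadrant : value R :=
  VCons (VCons (VNum a) (VNum c)) (VCons (VNum s1) (VNum s2)).

Lemma ev_undecided s :
  ev (size s) [:: VCons quadrant (items p u v s)] (fun=> undecided_fn)
    (items p u v [seq i <- s | ~~ decided i]) pass_time 0.
Proof.
apply: (ev_pass (res := fun s => items p u v [seq i <- s | ~~ decided i])) => //.
  by move=> l'; pass.
move=> x l' w w' /=; pass => //; case: ifPn => //; rewrite /decided.
- by rewrite negb_and => /orP[] ?; exfalso; lra.
- by rewrite negbK => /andP[? ?]; exfalso; lra.
- by rewrite negbK => /andP[? ?]; exfalso; lra.
Qed.

Lemma ev_fixed_u s :
  ev (size s) [:: VCons quadrant (items p u v s)] (fun=> fixed_u_fn)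
    (VNum (\sum_(i <- s | decided i && (0 <= s2 * v i)) u i)) pass_time 0.
Proof.
apply: (ev_pass (res := fun s =>
  VNum (\sum_(i <- s | decided i && (0 <= s2 * v i)) u i))) => //.
  by move=> l'; rewrite big_nil; pass.
move=> x l' w w' /=; rewrite big_cons; pass => //; rewrite /decided.
- by case: ifPn => //; rewrite !negb_and => /orP[/orP[]|] ?; exfalso; lra.
- by case: ifPn => // /andP[/andP[]] *; exfalso; lra.
- by case: ifPn => // /andP[/andP[]] *; exfalso; lra.
- by case: ifPn => // /andP[/andP[]] *; exfalso; lra.
Qed.

Lemma ev_fixed_v s :
  ev (size s) [:: VCons quadrant (items p u v s)] (fun=> fixed_v_fn)
    (VNum (\sum_(i <- s | decided i && (0 <= s2 * v i)) v i)) pass_time 0.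
Proof.
apply: (ev_pass (res := fun s =>
  VNum (\sum_(i <- s | decided i && (0 <= s2 * v i)) v i))) => //.
  by move=> l'; rewrite big_nil; pass.
move=> x l' w w' /=; rewrite big_cons; pass => //; rewrite /decided.
- by case: ifPn => //; rewrite !negb_and => /orP[/orP[]|] ?; exfalso; lra.
- by case: ifPn => // /andP[/andP[]] *; exfalso; lra.
- by case: ifPn => // /andP[/andP[]] *; exfalso; lra.
- by case: ifPn => // /andP[/andP[]] *; exfalso; lra.
Qed.

End Quadrant.

End PassLemmas.

(** * Passes with two lists or with larger steps *)

Section RecursivePasses.
Variable R : realFieldType.
Notation ev := (ev fns).

Section Merge.
Variables (T : Type) (p u v : T -> R) (a c s1 s2 : R).
Notation decided := (decided p u v a c s1 s2).
Notation quadrant := (quadrant a c s1 s2).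

Lemma ev_merge (x : T -> R) s :
  ev (size s) [:: VCons quadrant (VCons (items p u v s)
      (nums [seq x i | i <- s & ~~ decided i]))] (fun=> merge_fn)
    (nums [seq if decided i then if 0 <= s2 * v i then 1 else 0 else x i
          | i <- s]) pass_time 0.
Proof.
elim: s => [|y s IH].
  apply: ev_leq (leqnn _) _ _ _; last first.
  - by eapply ev_fn; eapply ev_match_nil; [evs|evs].
  - by [].
  - by [].
have [t h {}IH] := ev_own IH. refine (ev_rec (n := size s) h _).
case: (boolP (decided y)) => [hd|hd].
- have -> : [seq x i | i <- y :: s & ~~ decided i] =
            [seq x i | i <- s & ~~ decided i] by rewrite /= hd.
  move: (hd) => /andP[h1 h2].
  eapply ev_time_r; first eapply ev_fn; first eapply ev_match_cons.
  + by evs.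
  + eapply ev_if; [evs | evs | rewrite h1].
    eapply ev_if; [evs | evs | rewrite h2].
    eapply ev_eq; first eapply ev_cons.
    * by eapply ev_if_num => [| |_|_]; evs.
    * by eapply ev_call; [reflexivity | evs | exact: IH].
    by rewrite /= hd.
  + by [].
  + by [].
- have -> : [seq x i | i <- y :: s & ~~ decided i] =
            x y :: [seq x i | i <- s & ~~ decided i] by rewrite /= hd.
  have e : nums [seq if decided i then if 0 <= s2 * v i then 1 else 0 else x i
            | i <- y :: s] = VCons (VNum (x y)) (nums [seq if decided i then
              if 0 <= s2 * v i then 1 else 0 else x i | i <- s]).
    by rewrite /= (negbTE hd).
  rewrite e; case/nandP: hd => h1.
  + eapply ev_time_r; first eapply ev_fn; first eapply ev_match_cons.
    * by evs.
    * eapply ev_if; [evs | evs | rewrite (negbTE h1)].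
      by eapply ev_cons; [evs | eapply ev_call; [reflexivity | evs | exact: IH]].
    * by [].
    * by [].
  + have [h0|h0] := boolP (0 <= (p y - a * u y - c * v y) * (s2 * v y)).
    * eapply ev_time_r; first eapply ev_fn; first eapply ev_match_cons.
      - by evs.
      - eapply ev_if; [evs | evs | rewrite h0].
        eapply ev_if; [evs | evs | rewrite (negbTE h1)].
        by eapply ev_cons; [evs | eapply ev_call; [reflexivity | evs | exact: IH]].
      - by [].
      - by [].
    * eapply ev_time_r; first eapply ev_fn; first eapply ev_match_cons.
      - by evs.
      - eapply ev_if; [evs | evs | rewrite (negbTE h0)].
        by eapply ev_cons; [evs | eapply ev_call; [reflexivity | evs | exact: IH]].
      - by [].
      - by [].
Qed.

End Merge.

Lemma ev_zip (s1 s2 : seq (value R)) :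
  ev (size s1) [:: VCons (vlist s1) (vlist s2)] (fun=> zip_fn)
    (vlist [seq VCons x.1 x.2 | x <- zip s1 s2]) pass_time 0.
Proof.
elim: s1 s2 => [|x s1 IH] [|y s2].
1-3: by apply: ev_leq (leqnn _) _ _ _; last first;
  [eapply ev_fn; first [by eapply ev_match_nil; evs |
     by eapply ev_match_cons; [evs | eapply ev_match_nil; evs]] | | ].
have [t h {}IH] := ev_own (IH s2); refine (ev_rec (n := size s1) h _).
eapply ev_time_r; first eapply ev_fn; first eapply ev_match_cons.
- by evs.
- eapply ev_match_cons; first by evs.
  by eapply ev_cons; [evs | eapply ev_call; [reflexivity | evs | exact: IH]].
- by [].
- by [].
Qed.

Lemma ev_zip_map (T : Type) (f g : T -> value R) s :
  ev (size s) [:: VCons (vlist (map f s)) (vlist (map g s))] (fun=> zip_fn)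
    (vlist [seq VCons (f i) (g i) | i <- s]) pass_time 0.
Proof.
have -> : [seq VCons (f i) (g i) | i <- s] =
    [seq VCons x.1 x.2 | x <- zip (map f s) (map g s)].
  by elim: s => //= i s ->.
by have := ev_zip (map f s) (map g s); rewrite size_map.
Qed.

Lemma ev_zip_items (T : Type) (p u v x : T -> R) s :
  ev (size s) [:: VCons (items p u v s) (nums [seq x i | i <- s])]
    (fun=> zip_fn) (vlist [seq VCons (item (p i) (u i) (v i)) (VNum (x i))
                          | i <- s]) pass_time 0.
Proof. by rewrite /nums -map_comp; exact: ev_zip_map. Qed.

Lemma ev_zip_pairs (T : Type) (p u v : T -> R) s1 s2 :
  ev (size s1) [:: VCons (items p u v s1) (items p u v s2)] (fun=> zip_fn)
    (vlist [seq VCons (item (p ij.1) (u ij.1) (v ij.1))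
                      (item (p ij.2) (u ij.2) (v ij.2)) | ij <- zip s1 s2])
    pass_time 0.
Proof.
set f := fun i => item (p i) (u i) (v i).
have -> : [seq VCons (f ij.1) (f ij.2) | ij <- zip s1 s2] =
    [seq VCons x.1 x.2 | x <- zip (map f s1) (map f s2)].
  by elim: s1 s2 => [|i s1 IH] [|j s2] //=; rewrite IH.
by have := ev_zip (map f s1) (map f s2); rewrite size_map.
Qed.

Lemma ev_zip_nums (T : Type) (x y : T -> R) s :
  ev (size s) [:: VCons (nums [seq x i | i <- s]) (nums [seq y i | i <- s])]
    (fun=> zip_fn) (vlist [seq VCons (VNum (x i)) (VNum (y i)) | i <- s])
    pass_time 0.
Proof. by rewrite /nums -!map_comp; exact: ev_zip_map. Qed.

Definition med3 (a b c : R) : R :=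
  if a <= b then if b <= c then b else if a <= c then c else a
  else if a <= c then a else if b <= c then c else b.

Fixpoint thirds (l : seq (R * R)) : seq (R * R) :=
  match l with
  | x :: y :: z :: l' => (med3 x.1 y.1 z.1, 1) :: thirds l'
  | x :: _ => [:: (x.1, 1)]
  | [::] => [::]
  end.

Lemma thirds_ind (P : seq (R * R) -> Prop) :
  P [::] -> (forall x, P [:: x]) -> (forall x y, P [:: x; y]) ->
  (forall x y z l, P l -> P [:: x, y, z & l]) -> forall l, P l.
Proof.
move=> h0 h1 h2 h3 l; have [n] := ubnP (size l).
elim: n l => // n IH [|x [|y [|z l]]] //= hl.
by apply/h3/IH; rewrite -ltnS; apply: leq_trans hl; rewrite !ltnS ltnW.
Qed.

Lemma ev_thirds l :
  ev (size l) [:: points l] (fun=> thirds_fn) (points (thirds l)) pass_time 0.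
Proof.
elim/thirds_ind: l => [|x|x y|x y z l IH].
1-3: by apply: ev_leq (leqnn _) _ _ _; last first;
  [ eapply ev_fn; first [by eapply ev_match_nil; evs |
     eapply ev_match_cons; [evs | first [by eapply ev_match_nil; evs |
     eapply ev_match_cons; [evs | by eapply ev_match_nil; evs]]]] | | ].
apply: (@ev_leq _ _ (size l).+1 _ pass_time pass_time 0 0) => //.
  by rewrite /= !ltnS ltnW.
have [t h {}IH] := ev_own IH; refine (ev_rec (n := size l) h _).
eapply ev_time_r; first eapply ev_fn; first eapply ev_match_cons.
- by evs.
- eapply ev_match_cons; first by evs.
  eapply ev_match_cons; first by evs.
  eapply ev_cons.
    eapply ev_cons; last by evs.
    eapply ev_eq.
    do ?eapply ev_if_num => [| |_|_]; try by evs.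
    by [].
  by eapply ev_call; [reflexivity | evs | exact: IH].
- by [].
- by [].
Qed.

Lemma ev_parse (T : Type) (p u : T -> R) (k : T -> nat) (c : nat) s :
  ev (size s) [:: VCons (vnat R c)
      (vlist [seq vlist [:: VNum (p i); VNum (u i); vnat R (k i)] | i <- s])]
    (fun=> parse_fn)
    (items p u (fun i => if k i == c then 1 else -1) s) pass_time 0.
Proof.
apply: (ev_pass (res := items p u (fun i => if k i == c then 1 else -1))) => //.
  by move=> l'; pass.
move=> x l' w w'; pass => //=; congr (VCons (VCons _ (VCons _ (VNum _))) _).
- suff -> : k x == c by [].
  by rewrite eqn_leq -!(ler_nat R); apply/andP.
- suff /negbTE-> : k x != c by rewrite sub0r.
  by rewrite neq_ltn -!(ltr_nat R); apply/orP; left.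
- suff /negbTE-> : k x != c by rewrite sub0r.
  by rewrite neq_ltn -!(ltr_nat R); apply/orP; right.
Qed.


End RecursivePasses.

(** * Weighted selection in linear time *)

(** The recurrence of selection with medians of nine: the two recursive calls
    together get at most 8 n / 9 + 4 elements.  The additive constant matters
    for small n only, where any bound will do; [small] supplies one. *)
Lemma selection_recurrence k : exists (F : nat -> nat) (K : nat),
  [/\ forall n, (F n <= K * n.+1)%N, forall n, (k * n.+1 <= F n)%N
    & forall n a b, (a < n)%N -> (b < n)%N -> (9 * (a + b) <= 8 * n + 36)%N ->
      (k * n.+1 + F a + F b <= F n)%N].
Proof.
pose fix small n := if n is n'.+1 then (k * n.+1 + 2 * small n')%N else k.
have small_homo : {homo small : m n / (m <= n)%N}.
  by apply: homo_leq => [m||m] //=; [exact: leq_trans | lia].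
(* beyond this threshold the two calls get at most 35 / 36 of the points *)
have [n0 n0E] : exists n0, n0 = 108%N by exists 108%N.
have [K KE] : exists K, K = (small n0 + 36 * k)%N by eexists.
exists (fun n => if (n <= n0)%N then small n else (K * n.+1)%N), K.
have small_ge n : (k * n.+1 <= small n)%N by case: n => [|n] /=; lia.
have bound n : ((if (n <= n0)%N then small n else (K * n.+1)) <= K * n.+1)%N.
  case: ifP => // /small_homo h; apply: leq_trans h _.
  by rewrite KE mulnDl; apply: leq_trans (leq_addr _ _); exact: leq_pmulr.
split=> // [n|n a b an bn hab].
  case: ifP => // _; rewrite leq_mul2r; apply/orP; right.
  by rewrite KE -[leqLHS]mul1n (leq_trans _ (leq_addl _ _)) // leq_mul2r orbT.
have [hn|hn] := leqP n n0.
  have [-> ->] : (a <= n0)%N /\ (b <= n0)%N by lia.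
  case: n an bn hn {hab} => // n; rewrite !ltnS => /small_homo h1 /small_homo h2 _.
  by rewrite /=; lia.
apply: leq_trans (leq_add (leq_add (leqnn _) (bound a)) (bound b)) _.
have : (k * n.+1 * 36 <= K * n.+1)%N.
  by rewrite mulnAC leq_mul2r; apply/orP; right; rewrite KE; lia.
have : (K * a.+1 + K * b.+1 = K * (a + b).+2)%N by rewrite -mulnDr; congr muln; lia.
have : (K * (36 * (a + b).+2) <= K * (35 * n.+1))%N by rewrite leq_mul2l; apply/orP; right; lia.
by lia.
Qed.

Section Selection.
Variable R : realFieldType.
Notation ev := (ev fns).
Implicit Types (l : seq (R * R)) (t tau : R).

(** A median of three has one of the other two numbers on either side. *)
Lemma med3_count (P : pred R) a b c :
  (forall x y, x <= y -> P y -> P x) \/ (forall x y, x <= y -> P x -> P y) ->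
  P (med3 a b c) -> (1 < P a + P b + P c)%N.
Proof.
move=> mono; rewrite /med3.
case: (leP a b) => [|/ltW] ab; case: (leP b c) => [|/ltW] bc;
  case: (leP a c) => [|/ltW] ac.
all: case: mono => mono; move: (mono _ _ ab) (mono _ _ bc) (mono _ _ ac).
all: case: (P a); case: (P b); case: (P c) => //= h1 h2 h3 h4.
all: by first [have := h1 isT | have := h2 isT | have := h3 isT].
Qed.

(** The loss of 1 is due to a last group with fewer than three points. *)
Lemma thirds_count (P : pred R) l :
  (forall x y, x <= y -> P y -> P x) \/ (forall x y, x <= y -> P x -> P y) ->
  (2 * count (fun x => P x.1) (thirds l) <= (count (fun x => P x.1) l).+1)%N.
Proof.
move=> mono; elim/thirds_ind: l => [|x|x y|x y z l IH] //=.
- by case: (P _).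
- by case: (P _).
- have := @med3_count P x.1 y.1 z.1 mono; case: (P (med3 _ _ _)); lia.
Qed.

Lemma size_thirds l : (size l <= 3 * size (thirds l) <= size l + 2)%N.
Proof. by elim/thirds_ind: l => [|x|x y|x y z l IH] //=; lia. Qed.

Lemma size_thirds_leq l : (size (thirds l) <= size l)%N.
Proof. by have /andP[] := size_thirds l; lia. Qed.

Lemma size_thirds_lt l : (1 < size l)%N -> (size (thirds l) < size l)%N.
Proof. by have := size_thirds l; lia. Qed.

Lemma thirds_weights l : all (fun x => x.2 == 1) (thirds l).
Proof. by elim/thirds_ind: l => [|x|x y|x y z l IH] //=; rewrite eqxx. Qed.

Lemma sum_unit_weights (P : pred R) l : all (fun x => x.2 == 1) l ->
  \sum_(x <- l | P x.1) x.2 = (count (fun x => P x.1) l)%:R.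
Proof.
elim: l => [|x l IH] /=; first by rewrite big_nil.
move=> /andP[/eqP x1 /IH{}IH]; rewrite big_cons IH x1.
by case: (P _); rewrite ?add0n // natrD.
Qed.

(** [t] splits the weighted points [l] at [tau]: listing the points by
    decreasing position, the accumulated weight reaches [tau] at [t]. *)
Definition splits l tau t : Prop :=
  \sum_(x <- l | t < x.1) x.2 <= tau <= \sum_(x <- l | t <= x.1) x.2.

(** With unit weights and half of the total as a target, [splits] says that
    [t] is a median. *)
Lemma splits_median l t : all (fun x => x.2 == 1) l ->
  splits l ((\sum_(x <- l) x.2) / 2%:R) t ->
  (size l <= 2 * count (fun x => (x.1 <= t)%R) l)%N /\
  (size l <= 2 * count (fun x => (t <= x.1)%R) l)%N.
Proof.
move=> l1; rewrite /splits !(sum_unit_weights _ l1).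
rewrite (sum_unit_weights xpredT l1) count_predT => /andP[h1 h2].
have e : count (fun x => x.1 <= t) l = (size l - count (fun x => (t < x.1)%R) l)%N.
  rewrite -(count_predC (fun x => t < x.1) l) addKn.
  by apply: eq_count => x /=; rewrite leNgt.
have := count_size (fun x => (t < x.1)%R) l.
suff : (2 * count (fun x => (t < x.1)%R) l <= size l)%N /\
       (size l <= 2 * count (fun x => (t <= x.1)%R) l)%N by lia.
by split; rewrite -(ler_nat R) natrM; lra.
Qed.

Lemma thirds_thirds_median l t :
  let ms := thirds (thirds l) in
  splits ms ((\sum_(x <- ms) x.2) / 2%:R) t -> (0 < size l)%N ->
  [/\ (size [seq x <- l | (t < x.1)%R] < size l)%N,
      (size [seq x <- l | (x.1 < t)%R] < size l)%N,
      (9 * (size ms + size [seq x <- l | (t < x.1)%R]) <= 8 * size l + 36)%N &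
      (9 * (size ms + size [seq x <- l | (x.1 < t)%R]) <= 8 * size l + 36)%N].
Proof.
move=> ms; rewrite /ms => {ms} /(splits_median (thirds_weights _)) [] hle hge l0.
have mle : (forall x y : R, x <= y -> y <= t -> x <= t) by move=> x y; exact: le_trans.
have mge : (forall x y : R, x <= y -> t <= x -> t <= y).
  by move=> x y xy tx; exact: le_trans tx xy.
have arith n n1 n2 c c1 c2 : (n <= 3 * n1 <= n + 2 -> n1 <= 3 * n2 <= n1 + 2 ->
    n2 <= 2 * c2 -> 2 * c2 <= c1.+1 -> 2 * c1 <= c.+1 -> c <= n -> 0 < n ->
    n - c < n /\ 9 * (n2 + (n - c)) <= 8 * n + 36)%N by lia.
have [h1 h2] := arith _ _ _ _ _ _ (size_thirds l) (size_thirds _) hle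
  (thirds_count _ (or_introl mle)) (thirds_count _ (or_introl mle))
  (count_size _ _) l0.
have [h3 h4] := arith _ _ _ _ _ _ (size_thirds l) (size_thirds _) hge
  (thirds_count _ (or_intror mge)) (thirds_count _ (or_intror mge))
  (count_size _ _) l0.
have -> : size [seq x <- l | (t < x.1)%R] = (size l - count (fun x => (x.1 <= t)%R) l)%N.
  rewrite size_filter -(count_predC (fun x => x.1 <= t) l) addKn.
  by apply: eq_count => x /=; rewrite ltNge.
have -> : size [seq x <- l | (x.1 < t)%R] = (size l - count (fun x => (t <= x.1)%R) l)%N.
  rewrite size_filter -(count_predC (fun x => t <= x.1) l) addKn.
  by apply: eq_count => x /=; rewrite ltNge.
by split.
Qed.


Lemma filter_weights l (P : pred (R * R)) :
  all (fun x => 0 <= x.2) l -> all (fun x => 0 <= x.2) (filter P l).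
Proof. by elim: l => //= x l IH /andP[h /IH]; case: ifP => //= _ ->; rewrite h. Qed.

Lemma sum_weights_ge0 l (P : pred (R * R)) :
  all (fun x => 0 <= x.2) l -> 0 <= \sum_(x <- l | P x) x.2.
Proof.
elim: l => [|x l IH] /=; first by rewrite big_nil.
by move=> /andP[h /IH]; rewrite big_cons; case: (P x) => //; exact: addr_ge0.
Qed.

Lemma sum_below l t :
  \sum_(x <- l | t <= x.1) x.2 =
  \sum_(x <- l) x.2 - \sum_(x <- [seq x <- l | x.1 < t]) x.2.
Proof.
rewrite big_filter (bigID (fun x => x.1 < t) xpredT) /= addrC addrK.
by apply: eq_bigl => x; rewrite leNgt.
Qed.

(** The weight above [t] exceeds [tau], hence the splitting point lies above
    [t], where the list and its upper part agree. *)
Lemma splits_above l tau t t' : tau < \sum_(x <- [seq x <- l | t < x.1]) x.2 ->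
  splits [seq x <- l | t < x.1] tau t' -> splits l tau t'.
Proof.
move=> htau; rewrite /splits !big_filter_cond => /andP[h1 h2].
have tt' : t < t'.
  rewrite ltNge; apply/negP => t't; move: htau; rewrite ltNge => /negP; apply.
  apply: le_trans h1; rewrite big_filter le_eqVlt; apply/orP; left; apply/eqP.
  by apply: eq_bigl => x; case: ltP => //= /(le_lt_trans t't) ->.
rewrite (eq_bigl (fun x => t' < x.1)) in h1; last first.
  by move=> x /=; case: (ltP t' x.1) => [/(lt_trans tt')->|]; rewrite ?andbF.
rewrite (eq_bigl (fun x => t' <= x.1)) in h2; last first.
  by move=> x /=; case: (leP t' x.1) => [/(lt_le_trans tt')->|]; rewrite ?andbF.
by rewrite h1.
Qed.

Lemma splits_below l tau t t' :
  let rest := tau - \sum_(x <- l | t <= x.1) x.2 in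
  0 < rest -> splits [seq x <- l | x.1 < t] rest t' -> splits l tau t'.
Proof.
move=> rest hrest; rewrite /splits !big_filter_cond => /andP[h1 h2].
have t't : t' < t.
  rewrite ltNge; apply/negP => tt'; move: hrest; rewrite ltNge => /negP; apply.
  apply: le_trans h2 _; rewrite big_pred0 // => x.
  by apply/negP => /andP[xt /(le_trans tt')]; rewrite leNgt xt.
have split_at (P : pred R) : (forall x, t <= x -> P x) ->
    \sum_(x <- l | P x.1) x.2 = \sum_(x <- l | t <= x.1) x.2 +
    \sum_(x <- l | (x.1 < t) && P x.1) x.2.
  move=> hP; rewrite (bigID (fun x => t <= x.1)) /=; congr (_ + _).
    by apply: eq_bigl => x; case: leP => [/hP->|]; rewrite ?andbF.
  by apply: eq_bigl => x; rewrite -ltNge andbC.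
rewrite (split_at (fun y => t' < y)) => [|x]; last exact: lt_le_trans.
rewrite (split_at (fun y => t' <= y)) => [|x]; last exact/le_trans/ltW.
by move: h1 h2; rewrite /rest; lra.
Qed.

Definition select_time : nat := 15 * pass_time.

Lemma ev_select_rec (k0 : nat) (F : nat -> nat) : (select_time <= k0)%N ->
  (forall n, k0 * n.+1 <= F n)%N ->
  (forall n a b, (a < n)%N -> (b < n)%N -> (9 * (a + b) <= 8 * n + 36)%N ->
     (k0 * n.+1 + F a + F b <= F n)%N) ->
  forall l tau, all (fun x => 0 <= x.2) l -> 0 <= tau <= \sum_(x <- l) x.2 ->
  exists2 t, ev 0 [:: VCons (VNum tau) (points l)] (fun=> select_fn) (VNum t)
    0 (F (size l)) & splits l tau t.
Proof.
move=> hk0 F0 Frec l; have [n] := ubnP (size l); elim: n l => // n IH l ln tau l0 htau.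
suff [t [k] [r] [e hk hr] ht] : exists2 t, exists k r,
    [/\ ev (size l) [:: VCons (VNum tau) (points l)] (fun=> select_fn) (VNum t) k r,
        (k <= select_time)%N & (k0 * (size l).+1 + r <= F (size l))%N]
    & splits l tau t.
  exists t => //; apply: ev_leq (ev_flat e) => //; apply: leq_trans hr.
  by rewrite leq_add2r leq_mul2r (leq_trans hk hk0) orbT.
case: l => [|x [|y l]] in ln l0 htau *.
- exists 0; last by rewrite /splits !big_nil; rewrite big_nil in htau.
  eexists _, _; split; first by eapply ev_fn; eapply ev_match_nil; evs.
    by [].
  by rewrite !addn0.
- exists x.1.
    eexists _, _; split.
    + eapply ev_fn; eapply ev_match_cons; first by evs.
      by eapply ev_match_nil; evs.
    + by [].
    + by rewrite !addn0.
  by rewrite /splits !big_cons !big_nil ltxx lexx; rewrite big_cons big_nil in htau.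
set L := [:: x, y & l] in ln l0 htau *; set ms := thirds (thirds L).
have ms1 : all (fun x => x.2 == 1) ms by exact: thirds_weights.
have ms0 : all (fun x => 0 <= x.2) ms.
  by apply: sub_all ms1 => z /eqP->.
have msL : (size ms < size L)%N.
  apply: leq_ltn_trans (size_thirds_lt _); last by [].
  exact: size_thirds_leq.
have hms : 0 <= (\sum_(x <- ms) x.2) / 2%:R <= \sum_(x <- ms) x.2.
  by have := sum_weights_ge0 xpredT ms0; lra.
have [t et ht] := IH ms (leq_trans msL (ltnSE ln)) _ ms0 hms.
have [hi_lt lo_lt hi_le lo_le] := thirds_thirds_median ht isT.
set hi := [seq x <- L | t < x.1] in hi_lt hi_le.
set lo := [seq x <- L | x.1 < t] in lo_lt lo_le.
have loE : \sum_(x <- L) x.2 - \sum_(x <- lo) x.2 = \sum_(x <- L | t <= x.1) x.2.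
  by rewrite sum_below.
set rest := tau - (\sum_(x <- L) x.2 - \sum_(x <- lo) x.2).
have [t' [r [hr ht' hhi hstop hlo]]] : exists t' r,
  [/\ (k0 * (size L).+1 + F (size ms) + r <= F (size L))%N, splits L tau t',
      tau < \sum_(x <- hi) x.2 ->
        ev 0 [:: VCons (VNum tau) (points hi)] (fun=> select_fn) (VNum t') 0 r,
      \sum_(x <- hi) x.2 <= tau -> rest <= 0 -> t' = t
    & \sum_(x <- hi) x.2 <= tau -> 0 < rest ->
        ev 0 [:: VCons (VNum rest) (points lo)] (fun=> select_fn) (VNum t') 0 r].
  case: (ltP tau (\sum_(x <- hi) x.2)) => [htop|htop].
    have hhi : 0 <= tau <= \sum_(x <- hi) x.2 by lra.
    have [t' et' ht'] := IH hi (leq_trans hi_lt (ltnSE ln)) _ (filter_weights _ l0) hhi.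
    exists t', (F (size hi)); split=> //; first exact: Frec.
    exact: splits_above ht'.
  case: (leP rest 0) => [hrest|hrest].
    exists t, (F (size lo)); split=> //; first exact: Frec.
    rewrite /splits -big_filter htop -loE.
    by move: hrest; rewrite /rest; lra.
  have hlo : 0 <= rest <= \sum_(x <- lo) x.2.
    by rewrite (ltW hrest) /rest; lra.
  have [t' et' ht'] := IH lo (leq_trans lo_lt (ltnSE ln)) _ (filter_weights _ l0) hlo.
  exists t', (F (size lo)); split=> //; first exact: Frec.
  by move: hrest ht'; rewrite /rest loE; exact: splits_below.
exists t' => //; eexists _, _; split.
- eapply ev_fn; eapply ev_match_cons; first by evs.
  eapply ev_match_cons; first by evs.
  eapply ev_let.
    eapply ev_use; [reflexivity | | exact: (ev_thirds (thirds L)) |].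
      exact: size_thirds_leq.
    by eapply ev_use; [reflexivity | | exact: (ev_thirds L) | evs].
  eapply ev_let.
    eapply ev_call; [reflexivity | | exact: ev_widen et].
    eapply ev_cons; last by evs.
    eapply ev_div; [ | by evs | by rewrite pnatr_eq0].
    by eapply ev_use; [reflexivity | exact: (ltnW msL) | exact: (ev_total ms) | evs].
  eapply ev_let.
    by eapply ev_use; [reflexivity | | exact: (ev_above t L) | evs].
  eapply (ev_if (k3 := (5 * pass_time)%N) (r3 := r)); [ | by evs | ].
    by eapply ev_use; [reflexivity | exact: (ltnW hi_lt) | exact: (ev_total hi) | evs].
  case: leP => htop; last first.
    apply: (ev_leq (leqnn _) _ _); last first.
    + by eapply ev_call; [reflexivity | evs | exact: ev_widen (hhi htop)].
    + by rewrite !(addn0, add0n).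
    + by [].
  apply: (ev_leq (leqnn _) _ _); last first.
  + eapply ev_let.
      by eapply ev_use; [reflexivity | | exact: (ev_below t L) | evs].
    eapply ev_let.
      eapply ev_sub; first by evs.
      eapply ev_sub.
        by eapply ev_use; [reflexivity | | exact: (ev_total L) | evs].
      by eapply ev_use; [reflexivity | exact: (ltnW lo_lt) | exact: (ev_total lo) | evs].
    eapply (ev_if (k3 := 20) (r3 := r)); [by evs | by evs | ].
    rewrite -/rest; case: leP => hrest.
      rewrite (hstop htop hrest); apply: (ev_leq (leqnn _) _ _); last first.
      * by eapply ev_bound; reflexivity.
      * by [].
      * by [].
    apply: (ev_leq (leqnn _) _ _); last first.
    * by eapply ev_call; [reflexivity | evs | exact: ev_widen (hlo htop hrest)].
    * by rewrite !(addn0, add0n).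
    * by [].
  + by rewrite !(addn0, add0n).
  + by [].
- by [].
- by rewrite !(addn0, add0n) addnA.
Qed.

Lemma ev_select : exists K, forall l tau, all (fun x => 0 <= x.2) l ->
  0 <= tau <= \sum_(x <- l) x.2 ->
  exists2 t, ev (size l) [:: VCons (VNum tau) (points l)] (fun=> select_fn)
    (VNum t) K 0 & splits l tau t.
Proof.
have [F [K [FK F0 Frec]]] := selection_recurrence select_time; exists K => l tau l0 htau.
have [t [e et he] ht] := ev_select_rec (leqnn _) F0 Frec l0 htau.
by exists t => //; exists e => //; rewrite addn0; apply: leq_trans he (FK _).
Qed.

End Selection.

(** * One equality constraint, two objectives in lexicographic order *)

Definition box (R : realFieldType) (T : Type) (x : T -> R) : Prop :=
  forall i, 0 <= x i <= 1.

Section Attainable.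
Variables (R : realFieldType) (T : eqType).
Implicit Types (p a q x y : T -> R) (s : seq T) (S t : R).

(** The values of the sum of a x over x in the box form this interval. *)
Definition attainable s a S : Prop :=
  \sum_(i <- s | a i < 0) a i <= S <= \sum_(i <- s | 0 < a i) a i.

Lemma box_attainable s a x : box x -> attainable s a (\sum_(i <- s) a i * x i).
Proof.
move=> hx; rewrite /attainable !(big_mkcond (fun i => _ < _)) /=.
apply/andP; split; apply: ler_sum => i _; have /andP[x0 x1] := hx i.
  by case: ltP => h; [nra | exact: mulr_ge0].
by case: ltP => h; [nra | exact: mulr_le0_ge0].
Qed.

Lemma attainable_target s p a S : attainable s a S ->
  0 <= S + \sum_(i <- s | a i < 0) - a i <=
    \sum_(x <- [seq (p i / a i, `|a i|) | i <- s & a i != 0]) x.2.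
Proof.
rewrite /attainable big_map big_filter /=.
have -> : \sum_(i <- s | a i != 0) `|a i| =
    \sum_(i <- s | 0 < a i) a i + \sum_(i <- s | a i < 0) - a i.
  rewrite (big_mkcond (fun i => _ != _)) !(big_mkcond (fun i => _ < _)).
  rewrite -big_split /=; apply: eq_bigr => i _.
  by case: (ltrgt0P (a i)); rewrite ?addr0 ?add0r // => ->; rewrite ltxx.
by rewrite sumrN; lra.
Qed.

(** A multiplier [t] splits the breakpoints p / a exactly if some point with
    sum S maximises the reduced profit p - t a: the items with positive reduced
    profit are taken entirely, and those with reduced profit zero make up for
    the rest. *)
Lemma splits_attainable s p a S t :
  splits [seq (p i / a i, `|a i|) | i <- s & a i != 0]
    (S + \sum_(i <- s | a i < 0) - a i) t ->
  attainable [seq i <- s | p i - t * a i == 0] a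
    (S - \sum_(i <- s | 0 < p i - t * a i) a i).
Proof.
rewrite /splits /attainable !big_map !big_filter_cond /=.
have e1 : \sum_(i <- s | (a i != 0) && (t < p i / a i)) `|a i| =
    \sum_(i <- s | 0 < p i - t * a i) a i +
    \sum_(i <- s | (p i - t * a i == 0) && (a i < 0)) a i +
    \sum_(i <- s | a i < 0) - a i.
  rewrite !(big_mkcond (fun i => _ && _)) !(big_mkcond (fun i => _ < _)) /=.
  rewrite -!big_split /=; apply: eq_bigr => i _.
  case: (ltrgt0P (a i)) => [a0|a0|->] /=.
  - by rewrite ltr_pdivlMr // andbF subr_gt0; case: ifP => _; ring.
  - rewrite ltr_ndivlMr // andbT subr_gt0.
    by rewrite subr_eq0; case: (ltrgtP (p i) (t * a i)) => _ /=; ring.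
  - by rewrite andbF; case: ifP; rewrite !addr0.
have e2 : \sum_(i <- s | (a i != 0) && (t <= p i / a i)) `|a i| =
    \sum_(i <- s | 0 < p i - t * a i) a i +
    \sum_(i <- s | (p i - t * a i == 0) && (0 < a i)) a i +
    \sum_(i <- s | a i < 0) - a i.
  rewrite !(big_mkcond (fun i => _ && _)) !(big_mkcond (fun i => _ < _)) /=.
  rewrite -!big_split /=; apply: eq_bigr => i _.
  case: (ltrgt0P (a i)) => [a0|a0|->] /=.
  - rewrite ler_pdivlMr // andbT subr_gt0.
    by rewrite subr_eq0; case: (ltrgtP (p i) (t * a i)) => _ /=; ring.
  - by rewrite ler_ndivlMr // andbF subr_gt0 leNgt; case: ltP => _ /=; ring.
  - by rewrite andbF; case: ifP; rewrite !addr0.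
by rewrite e1 e2; lra.
Qed.

Lemma sum_reduced s p a x t :
  \sum_(i <- s) (p i - t * a i) * x i =
  \sum_(i <- s) p i * x i - t * \sum_(i <- s) a i * x i.
Proof.
by rewrite mulr_sumr -sumrB; apply: eq_bigr => i _; ring.
Qed.

Lemma all_sum_ge0 s (f : T -> R) :
  all (fun i => 0 <= f i) s -> 0 <= \sum_(i <- s) f i.
Proof.
elim: s => [|i s IH] /=; first by rewrite big_nil.
by move=> /andP[h /IH]; rewrite big_cons; exact: addr_ge0.
Qed.

Definition lex_best s p a q S x : Prop :=
  [/\ box x, \sum_(i <- s) a i * x i = S,
      forall y, box y -> \sum_(i <- s) a i * y i = S ->
        \sum_(i <- s) p i * y i <= \sum_(i <- s) p i * x i
    & forall y, box y -> \sum_(i <- s) a i * y i = S ->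
        \sum_(i <- s) p i * x i <= \sum_(i <- s) p i * y i ->
        \sum_(i <- s) q i * y i <= \sum_(i <- s) q i * x i].

(** The values of p and of p - t a differ by a constant on the feasible set, and
    the reduced profit is maximised coordinate by coordinate.  A solution that
    is as good as [x] agrees with it wherever the reduced profit is nonzero, so
    that the same argument applies to q on the remaining coordinates. *)
Lemma lex_bestP s p a q S t t2 x : box x -> \sum_(i <- s) a i * x i = S ->
  (forall i, 0 < p i - t * a i -> x i = 1) ->
  (forall i, p i - t * a i < 0 -> x i = 0) ->
  (forall i, p i - t * a i = 0 -> 0 < q i - t2 * a i -> x i = 1) ->
  (forall i, p i - t * a i = 0 -> q i - t2 * a i < 0 -> x i = 0) ->
  lex_best s p a q S x.
Proof.
move=> hx xS h1 h2 h3 h4.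
have gain y : box y -> \sum_(i <- s) a i * y i = S ->
    forall c (f : T -> R), \sum_(i <- s) f i * x i - \sum_(i <- s) f i * y i =
    \sum_(i <- s) (f i - c * a i) * (x i - y i).
  move=> hy yS c f; transitivity (\sum_(i <- s) (f i - c * a i) * x i -
    \sum_(i <- s) (f i - c * a i) * y i).
    by rewrite !sum_reduced xS yS; ring.
  by rewrite -sumrB; apply: eq_bigr => i _; ring.
have term y i : box y -> 0 <= (p i - t * a i) * (x i - y i).
  move=> hy; have /andP[y0 y1] := hy i.
  case: (ltrgt0P (p i - t * a i)) => h.
  - by rewrite (h1 i h) mulr_ge0 ?(ltW h) // subr_ge0.
  - by rewrite (h2 i h) mulr_le0 ?(ltW h) // sub0r oppr_le0.
  - by rewrite h mul0r.
split=> // [y hy yS|y hy yS hle].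
  by rewrite -subr_ge0 (gain y hy yS t); apply: sumr_ge0 => i _; exact: term.
rewrite -subr_ge0 (gain y hy yS t2); apply: all_sum_ge0.
have : \sum_(i <- s) (p i - t * a i) * (x i - y i) == 0.
  rewrite eq_le sumr_ge0 ?andbT => [|i _]; last exact: term.
  by rewrite -(gain y hy yS t) subr_le0.
rewrite psumr_eq0 => [|i _]; last exact: term.
apply: sub_all => i /=; rewrite mulf_eq0 => /orP[/eqP h|/eqP ->]; last by rewrite mulr0.
have /andP[y0 y1] := hy i; case: (ltrgt0P (q i - t2 * a i)) => h'.
- by rewrite (h3 i h h') mulr_ge0 ?(ltW h') // subr_ge0.
- by rewrite (h4 i h h') mulr_le0 ?(ltW h') // sub0r oppr_le0.
- by rewrite h' mul0r.
Qed.

Lemma sum_threshold s a (r : T -> R) x :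
  (forall i, 0 < r i -> x i = 1) -> (forall i, r i < 0 -> x i = 0) ->
  \sum_(i <- s) a i * x i =
  \sum_(i <- s | 0 < r i) a i + \sum_(i <- [seq i <- s | r i == 0]) a i * x i.
Proof.
move=> h1 h2; rewrite big_filter [RHS]addrC !(big_mkcond (fun i => _ < _)).
rewrite !(big_mkcond (fun i => _ == _)) -big_split /=; apply: eq_bigr => i _.
case: (ltrgt0P (r i)) => [/h1->|/h2->|_]; last by rewrite addr0.
  by rewrite add0r mulr1.
by rewrite mulr0 addr0.
Qed.

(** The share of the positive items among those that are tied in both
    objectives, the negative ones getting the complementary share. *)
Definition share s p a S : R :=
  let d := \sum_(x <- [seq (p i / a i, `|a i|) | i <- s & a i != 0]) x.2 in
  if d <= 0 then 0 else (S + \sum_(i <- s | a i < 0) - a i) / d.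

Lemma share_bounds s p a S : attainable s a S -> 0 <= share s p a S <= 1.
Proof.
move=> /(attainable_target p) /andP[h1 h2]; rewrite /share.
set d := \sum_(x <- _) x.2 in h2 *; case: (leP d 0) => [_|d0]; first by rewrite lexx ler01.
by rewrite divr_ge0 ?(ltW d0) //= ler_pdivrMr // mul1r.
Qed.

(** The sum is the one of the negative coefficients, plus the share of the sum of
    all absolute values. *)
Lemma sum_share s p a S : attainable s a S ->
  \sum_(i <- s) a i * (if 0 < a i then share s p a S else 1 - share s p a S) = S.
Proof.
move=> hS; have /andP[h1 h2] := attainable_target p hS.
set th := share s p a S.
have -> : \sum_(i <- s) a i * (if 0 < a i then th else 1 - th) =
  th * \sum_(x <- [seq (p i / a i, `|a i|) | i <- s & a i != 0]) x.2 -
  \sum_(i <- s | a i < 0) - a i.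
  rewrite big_map big_filter /= mulr_sumr !(big_mkcond (fun i => _ != _)).
  rewrite !(big_mkcond (fun i => _ < _)) -sumrB; apply: eq_bigr => i _ /=.
  case: (ltrgt0P (a i)) => [a0|a0|->] /=; [by ring | by ring |].
  by rewrite mul0r subr0.
rewrite /th /share; set d := \sum_(x <- _) x.2 in h2 *.
case: (leP d 0) => [d0|d0]; last by rewrite divfK ?gt_eqF //; ring.
by rewrite mul0r; lra.
Qed.

End Attainable.

Section TwoObjectives.
Variable R : realFieldType.
Notation ev := (ev fns).

Lemma ev_multiplier : exists K, forall (T : eqType) (p a q : T -> R) s S,
  attainable s a S ->
  exists2 t, ev (size s) [:: VCons (VNum S) (items p a q s)]
      (fun=> multiplier_fn) (VNum t) K 0 &
    attainable [seq i <- s | p i - t * a i == 0] a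
      (S - \sum_(i <- s | 0 < p i - t * a i) a i).
Proof.
have [K hK] := ev_select R; eexists => T p a q s S hS.
have [|t et ht] := hK _ _ _ (attainable_target p hS).
  by rewrite all_map; apply/allP => i _ /=.
exists t; last exact: splits_attainable ht.
eapply ev_fn; eapply (ev_leq (leqnn _) (leqnn _)); last first.
  eapply ev_use; [reflexivity | | exact: et | ].
    by rewrite size_map size_filter_leq.
  eapply ev_cons.
    eapply ev_add; first by evs.
    by eapply ev_use; [reflexivity | | exact: (ev_deficit p a q s) | evs].
  by eapply ev_use; [reflexivity | | exact: (ev_breaks p a q s) | evs].
by [].
Qed.

Lemma ev_lexopt : exists K, forall (T : eqType) (p a q : T -> R) s S,
  attainable s a S ->
  exists2 x, ev (size s) [:: VCons (VNum S) (items p a q s)]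
      (fun=> lexopt_fn) (nums [seq x i | i <- s]) K 0 & lex_best s p a q S x.
Proof.
have [K hK] := ev_multiplier; eexists => T p a q s S hS.
have [t et ht] := hK T p a q s S hS.
set s1 := [seq i <- s | _] in ht; set S1 := S - _ in ht.
have [t2 et2 ht2] := hK T q a q s1 S1 ht.
set s2 := [seq i <- s1 | _] in ht2; set S2 := S1 - _ in ht2.
have size1 : (size s1 <= size s)%N by exact: size_filter_leq.
have size2 : (size s2 <= size s)%N.
  by apply: leq_trans (size_filter_leq _ _) size1.
pose th := share s2 q a S2.
pose x i := lex_value t t2 th (p i) (a i) (q i).
have /andP[th0 th1] : 0 <= th <= 1 by exact: share_bounds.
exists x; last first.
  apply: (@lex_bestP _ _ s p a q S t t2).
  - move=> i; rewrite /x /lex_value.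
    by do 5?[case: ifP => _]; rewrite ?lexx ?ler01 // ?th0 // subr_ge0 th1 gerBl.
  - rewrite (@sum_threshold _ _ s a (fun i => p i - t * a i)) => [|i h|i h].
    + have -> : \sum_(i <- s1) a i * x i = S1; last by rewrite /S1; ring.
      pose y i := if 0 < q i - t2 * a i then 1 else
        if q i - t2 * a i < 0 then 0 else if 0 < a i then th else 1 - th.
      transitivity (\sum_(i <- s1) a i * y i).
        apply: eq_big_seq => i; rewrite mem_filter => /andP[/eqP h _].
        by rewrite /x /lex_value h ltxx.
      rewrite (@sum_threshold _ _ s1 a (fun i => q i - t2 * a i)) => [|i h|i h].
      * have -> : \sum_(i <- s2) a i * y i = S2; last by rewrite /S2; ring.
        rewrite -[RHS](sum_share q ht2); apply: eq_big_seq => i.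
        by rewrite mem_filter => /andP[/eqP h _]; rewrite /y h ltxx.
      * by rewrite /y h.
      * by rewrite /y ltNge (ltW h) h.
    + by rewrite /x /lex_value h.
    + by rewrite /x /lex_value ltNge (ltW h) h.
  - by move=> i h; rewrite /x /lex_value h.
  - by move=> i h; rewrite /x /lex_value ltNge (ltW h) h.
  - by move=> i h h'; rewrite /x /lex_value h ltxx h'.
  - by move=> i h h'; rewrite /x /lex_value h ltxx ltNge (ltW h') h'.
eapply ev_fn; eapply (ev_leq (leqnn _) (leqnn _)); last first.
  eapply ev_let.
    by eapply ev_use; [reflexivity | | exact: et | evs].
  eapply ev_let.
    by eapply ev_use; [reflexivity | | exact: (ev_tied p a q t s) | evs].
  eapply ev_let.
    eapply ev_sub; first by evs.
    by eapply ev_use; [reflexivity | | exact: (ev_filled p a q t s) | evs].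
  eapply ev_let.
    by eapply ev_use; [reflexivity | exact: size1 | exact: et2 | evs].
  eapply ev_let.
    by eapply ev_use; [reflexivity | exact: size1 | exact: (ev_tied q a q t2 s1) | evs].
  eapply ev_let.
    eapply ev_sub; first by evs.
    by eapply ev_use; [reflexivity | exact: size1 | exact: (ev_filled q a q t2 s1) | evs].
  eapply ev_let.
    eapply ev_use; [reflexivity | | exact: (ev_total [seq (q i / a i, `|a i|) | i <- s2 & a i != 0]) |].
      by rewrite size_map; apply: leq_trans (size_filter_leq _ _) size2.
    eapply ev_cons; first by evs.
    by eapply ev_use; [reflexivity | exact: size2 | exact: (ev_breaks q a q s2) | evs].
  eapply ev_let.
    eapply ev_if_num; [by evs | by evs | move=> _; by evs | move=> hd].
    eapply ev_div; [ | by evs | by rewrite gt_eqF].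
    eapply ev_add; first by evs.
    by eapply ev_use; [reflexivity | exact: size2 | exact: (ev_deficit q a q s2) | evs].
  by eapply ev_use; [reflexivity | | exact: (ev_assign p a q t t2 th s) | evs].
by [].
Qed.


Section Sides.
Variables (T : eqType) (p a q x : T -> R) (s : seq T) (S Q : R).
Hypothesis best : lex_best s p a q S x.

(** Moving from the objective p to p + delta q, the optimum can only reach a
    larger sum of q if delta is positive. *)
Lemma side_of_best (y : T -> R) (delta : R) : box y ->
  \sum_(i <- s) a i * y i = S -> \sum_(i <- s) q i * y i = Q ->
  (forall z, box z -> \sum_(i <- s) a i * z i = S ->
     \sum_(i <- s) (p i + delta * q i) * z i <=
     \sum_(i <- s) (p i + delta * q i) * y i) ->
  \sum_(i <- s) q i * x i < Q -> 0 < delta.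
Proof.
case: best => hx xS hp hq hy yS yQ ymax xQ.
have split_obj (z : T -> R) : \sum_(i <- s) (p i + delta * q i) * z i =
    \sum_(i <- s) p i * z i + delta * \sum_(i <- s) q i * z i.
  by rewrite mulr_sumr -big_split; apply: eq_bigr => i _ /=; ring.
have := ymax x hx xS; rewrite !split_obj yQ => h.
have h' := hp y hy yS; have h'' := hq y hy yS.
rewrite ltNge; apply/negP => d0.
have hle : \sum_(i <- s) p i * x i <= \sum_(i <- s) p i * y i by nra.
by have := h'' hle; rewrite yQ leNgt xQ.
Qed.

End Sides.

(** [sg] is the sign of the change in the price of q which leads from p to an
    objective whose optimum has sum Q. *)
Definition points_to (T : eqType) (p a q : T -> R) s S Q (sg : R) : Prop :=
  forall (y : T -> R) (delta : R), box y ->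
    \sum_(i <- s) a i * y i = S -> \sum_(i <- s) q i * y i = Q ->
    (forall z, box z -> \sum_(i <- s) a i * z i = S ->
       \sum_(i <- s) (p i + delta * q i) * z i <=
       \sum_(i <- s) (p i + delta * q i) * y i) ->
    0 < sg * delta.

(** This is stronger than optimality under both constraints. *)
Definition optimal_with (T : eqType) (p a q : T -> R) s S Q (x : T -> R) : Prop :=
  [/\ box x, \sum_(i <- s) a i * x i = S, \sum_(i <- s) q i * x i = Q
    & forall y, box y -> \sum_(i <- s) a i * y i = S ->
        \sum_(i <- s) p i * y i <= \sum_(i <- s) p i * x i].

(** Both solutions maximise p, and so do their convex combinations. *)
Lemma optimal_mix (T : eqType) (p a q : T -> R) s S Q x1 x2 :
  lex_best s p a q S x1 -> lex_best s p a (fun i => - q i) S x2 ->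
  \sum_(i <- s) q i * x2 i <= Q <= \sum_(i <- s) q i * x1 i ->
  let hi := \sum_(i <- s) q i * x1 i in let lo := \sum_(i <- s) q i * x2 i in
  let th := if hi <= lo then 0 else (Q - lo) / (hi - lo) in
  optimal_with p a q s S Q (fun i => th * x1 i + (1 - th) * x2 i).
Proof.
move=> [b1 S1 o1 _] [b2 S2 o2 _] /andP[h2 h1] hi lo th.
rewrite -/hi -/lo in h1 h2.
have th01 : 0 <= th <= 1.
  rewrite /th; case: (leP hi lo) => [_|h]; first by rewrite lexx ler01.
  have d0 : 0 < hi - lo by lra.
  by rewrite divr_ge0 ?(ltW d0) ?subr_ge0 //= ler_pdivrMr // mul1r lerD2r.
have thQ : th * hi + (1 - th) * lo = Q.
  rewrite /th; case: (leP hi lo) => [h|h]; first by lra.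
  have d0 : hi - lo != 0 by lra.
  by field.
have lin (f : T -> R) : \sum_(i <- s) f i * (th * x1 i + (1 - th) * x2 i) =
    th * (\sum_(i <- s) f i * x1 i) + (1 - th) * \sum_(i <- s) f i * x2 i.
  by rewrite !mulr_sumr -big_split; apply: eq_bigr => i _ /=; ring.
move: th01 => /andP[th0 th1]; split.
- move=> i; have /andP[? ?] := b1 i; have /andP[? ?] := b2 i.
  by apply/andP; split; nra.
- by rewrite lin S1 S2; ring.
- by rewrite lin.
- move=> y hy yS; rewrite lin.
  by have := o1 y hy yS; have := o2 y hy yS; nra.
Qed.

(** A test either solves the problem or says in which direction the price of q
    has to move. *)
Definition verdict (T : eqType) (p a q : T -> R) s S Q sg (res : value R) : Prop :=
  (sg = 0 /\ exists2 x, res = nums [seq x i | i <- s] &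
               optimal_with p a q s S Q x) \/
  ((sg = 1 \/ sg = -1) /\ points_to p a q s S Q sg).

Lemma ev_test : exists K, forall (T : eqType) (p a q : T -> R) s S Q,
  attainable s a S ->
  exists sg res, ev (size s) [:: VCons (VCons (VNum S) (VNum Q)) (items p a q s)]
      (fun=> test_fn) (VCons (VNum sg) res) K 0 /\
    verdict p a q s S Q sg res.
Proof.
have [K hK] := ev_lexopt; eexists => T p a q s S Q hS.
have [x1 e1 h1] := hK T p a q s S hS.
have [x2 e2 h2] := hK T p a (fun i => - q i) s S hS.
set hi := \sum_(i <- s) q i * x1 i; set lo := \sum_(i <- s) q i * x2 i.
pose th := if hi <= lo then 0 else (Q - lo) / (hi - lo).
pose sg : R := if Q <= hi then if lo <= Q then 0 else -1 else 1.
pose res : value R := if Q <= hi then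
   if lo <= Q then nums [seq th * x1 i + (1 - th) * x2 i | i <- s] else VNil
  else VNil.
exists sg, res; split; last first.
  rewrite /verdict /sg /res; case: (leP Q hi) => [hQ|Qhi]; last first.
    right; split; [by left | move=> y d hy yS yQ ymax; rewrite mul1r].
    exact: side_of_best h1 _ _ hy yS yQ ymax Qhi.
  case: (leP lo Q) => [Qlo|loQ].
    left; split=> //; eexists; first by [].
    by apply: optimal_mix => //; rewrite -/lo -/hi Qlo.
  right; split; [by right | move=> y d hy yS yQ ymax; rewrite mulN1r].
  apply: (side_of_best (y := y) (delta := - d) (Q := - Q) h2) => //.
  - by rewrite -yQ -sumrN; apply: eq_bigr => i _; ring.
  - move=> z hz zS; have := ymax z hz zS.
    have e (f : T -> R) : \sum_(i <- s) (p i + - d * - q i) * f i =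
        \sum_(i <- s) (p i + d * q i) * f i.
      by apply: eq_bigr => i _; rewrite mulrNN.
    by rewrite !e.
  - rewrite -(opprK (\sum_(i <- s) _)) ltrN2 -sumrN.
    by under eq_bigr do rewrite mulNr opprK.
eapply ev_fn; eapply (ev_leq (leqnn _) (leqnn _)); last first.
  eapply ev_let.
    by eapply ev_use; [reflexivity | | exact: e1 | evs].
  eapply ev_let.
    eapply ev_use; [reflexivity | | exact: (ev_dot p a q x1 s) | ].
      by [].
    eapply ev_cons; first by evs.
    by eapply ev_use; [reflexivity | | exact: (ev_zip_items p a q x1 s) | evs].
  rewrite -/hi; eapply ev_if_both; [by evs | by evs | move=> hQ | move=> hQ].
    eapply ev_let.
      eapply ev_use; [reflexivity | | exact: e2 | ].
        by [].
      eapply ev_cons; first by evs.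
      by eapply ev_use; [reflexivity | | exact: (ev_negate p a q s) | evs].
    eapply ev_let.
      eapply ev_use; [reflexivity | | exact: (ev_dot p a q x2 s) | ].
        by [].
      eapply ev_cons; first by evs.
      by eapply ev_use; [reflexivity | | exact: (ev_zip_items p a q x2 s) | evs].
    rewrite -/lo; eapply ev_if_both; [by evs | by evs | move=> lQ | move=> lQ].
      eapply ev_let.
        eapply ev_if_num; [by evs | by evs | move=> _; by evs | move=> hd].
        by eapply ev_div; [evs | evs | lra].
      rewrite -/th /sg /res hQ lQ; eapply ev_cons; first by evs.
      eapply ev_use; [reflexivity | | exact: (ev_mix th x1 x2 s) | ].
        by [].
      eapply ev_cons; first by evs.
      by eapply ev_use; [reflexivity | | exact: (ev_zip_nums x1 x2 s) | evs].
    by rewrite /sg /res hQ leNgt lQ /=; eapply ev_eq; [evs | rewrite sub0r].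
  by rewrite /sg /res leNgt hQ /=; evs.
by [].
Qed.

End TwoObjectives.

(** * Two equality constraints *)

Section TwoConstraints.
Variable R : realFieldType.
Notation ev := (ev fns).

(** Complementary slackness: the prices [lam] and [mu] certify that [x] is
    optimal. *)
Definition priced_optimum (T : eqType) (p u v : T -> R) s U V x lam mu : Prop :=
  [/\ box x, \sum_(i <- s) u i * x i = U, \sum_(i <- s) v i * x i = V,
      forall i, 0 < p i - lam * u i - mu * v i -> x i = 1
    & forall i, p i - lam * u i - mu * v i < 0 -> x i = 0].

Definition optimal2 (T : eqType) (p u v : T -> R) s U V (x : T -> R) : Prop :=
  [/\ box x, \sum_(i <- s) u i * x i = U, \sum_(i <- s) v i * x i = V
    & forall y, box y -> \sum_(i <- s) u i * y i = U ->
        \sum_(i <- s) v i * y i = V ->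
        \sum_(i <- s) p i * y i <= \sum_(i <- s) p i * x i].

Section Pricing.
Variables (T : eqType) (p u v x : T -> R) (s : seq T) (U V lam mu : R).
Hypothesis best : priced_optimum p u v s U V x lam mu.

Lemma sum_priced (y : T -> R) :
  \sum_(i <- s) (p i - lam * u i - mu * v i) * y i =
  \sum_(i <- s) p i * y i - lam * \sum_(i <- s) u i * y i
  - mu * \sum_(i <- s) v i * y i.
Proof. by rewrite !mulr_sumr -!sumrB; apply: eq_bigr => i _; ring. Qed.

Lemma priced_max (y : T -> R) : box y ->
  \sum_(i <- s) (p i - lam * u i - mu * v i) * y i <=
  \sum_(i <- s) (p i - lam * u i - mu * v i) * x i.
Proof.
case: best => hx _ _ h1 h0 hy; apply: ler_sum => i _; have /andP[y0 y1] := hy i.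
case: (ltrgt0P (p i - lam * u i - mu * v i)) => h.
- by rewrite h1 // mulr1; nra.
- by rewrite h0 // mulr0; nra.
- by rewrite h !mul0r.
Qed.

Lemma priced_optimum_optimal : optimal2 p u v s U V x.
Proof.
have [hx xU xV _ _] := best; split=> // y hy yU yV.
by have := priced_max hy; rewrite !sum_priced xU xV yU yV; lra.
Qed.

(** The optimum with prices [lam] and [mu] also maximises p - lam u under the
    constraint on v alone, and this objective is p - a u changed by a - lam
    times u. *)
Lemma priced_points_u (a : R) sg :
  points_to (fun i => p i - a * u i) v u s V U sg -> 0 < sg * (a - lam).
Proof.
have [hx xU xV _ _] := best; apply => //; last move=> z hz zV.
have e (y : T -> R) : \sum_(i <- s) (p i - a * u i + (a - lam) * u i) * y i =
    \sum_(i <- s) (p i - lam * u i - mu * v i) * y i +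
    mu * \sum_(i <- s) v i * y i.
  by rewrite mulr_sumr -big_split; apply: eq_bigr => i _ /=; ring.
by rewrite !e xV zV lerD2r priced_max.
Qed.

Lemma priced_points_v (c : R) sg :
  points_to (fun i => p i - c * v i) u v s U V sg -> 0 < sg * (c - mu).
Proof.
have [hx xU xV _ _] := best; apply => //; last move=> z hz zU.
have e (y : T -> R) : \sum_(i <- s) (p i - c * v i + (c - mu) * v i) * y i =
    \sum_(i <- s) (p i - lam * u i - mu * v i) * y i +
    lam * \sum_(i <- s) u i * y i.
  by rewrite mulr_sumr -big_split; apply: eq_bigr => i _ /=; ring.
by rewrite !e xU zU lerD2r priced_max.
Qed.

Lemma optimal_with_u (a : R) (y : T -> R) :
  optimal_with (fun i => p i - a * u i) v u s V U y -> optimal2 p u v s U V y.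
Proof.
move=> [hy yV yU ymax]; split=> // z hz zU zV.
have := ymax z hz zV; have e (f : T -> R) : \sum_(i <- s) (p i - a * u i) * f i =
    \sum_(i <- s) p i * f i - a * \sum_(i <- s) u i * f i.
  by rewrite mulr_sumr -sumrB; apply: eq_bigr => i _; ring.
by rewrite !e yU zU lerD2r.
Qed.

Lemma optimal_with_v (c : R) (y : T -> R) :
  optimal_with (fun i => p i - c * v i) u v s U V y -> optimal2 p u v s U V y.
Proof.
move=> [hy yU yV ymax]; split=> // z hz zU zV.
have := ymax z hz zU; have e (f : T -> R) : \sum_(i <- s) (p i - c * v i) * f i =
    \sum_(i <- s) p i * f i - c * \sum_(i <- s) v i * f i.
  by rewrite mulr_sumr -sumrB; apply: eq_bigr => i _; ring.
by rewrite !e yV zV lerD2r.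
Qed.

Hypothesis v0 : forall i, v i != 0.
Variables (a c s1 s2 : R).
Hypotheses (s1E : s1 = 1 \/ s1 = -1) (s2E : s2 = 1 \/ s2 = -1).
Hypotheses (h1 : 0 < s1 * (a - lam)) (h2 : 0 < s2 * (c - mu)).

(** The dual line of a decided item does not meet the open quadrant that
    contains the optimal prices. *)
Lemma decided_value i : decided p u v a c s1 s2 i ->
  x i = if 0 <= s2 * v i then 1 else 0.
Proof.
have [_ _ _ x1 x0] := best; move=> /andP[d1 d2]; have vi := v0 i.
have e : p i - lam * u i - mu * v i = (p i - a * u i - c * v i) +
  (a - lam) * u i + (c - mu) * v i by ring.
have s2v : s2 * v i != 0.
  by rewrite mulf_neq0 //; case: s2E => ->; rewrite ?oppr_eq0 oner_eq0.
case: leP => hs.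
  have {}hs : 0 < s2 * v i by rewrite lt_neqAle eq_sym s2v.
  apply: x1; rewrite e.
  have r0 : 0 <= p i - a * u i - c * v i by rewrite -(pmulr_lge0 _ hs).
  have u0 : 0 <= s1 * u i by rewrite -(pmulr_lge0 _ hs).
  by case: s1E s2E h1 h2 u0 hs => -> [] ->; nra.
apply: x0; rewrite e.
have r0 : p i - a * u i - c * v i <= 0 by rewrite -(nmulr_lge0 _ hs).
have u0 : s1 * u i <= 0 by rewrite -(nmulr_lge0 _ hs).
by case: s1E s2E h1 h2 u0 hs => -> [] ->; nra.
Qed.

Lemma sum_decided (f y : T -> R) :
  let rest := [seq i <- s | ~~ decided p u v a c s1 s2 i] in
  \sum_(i <- s) f i * (if decided p u v a c s1 s2 i then
                         if 0 <= s2 * v i then 1 else 0 else y i) =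
  \sum_(i <- s | decided p u v a c s1 s2 i && (0 <= s2 * v i)) f i +
  \sum_(i <- rest) f i * y i.
Proof.
move=> rest; rewrite big_filter (bigID (decided p u v a c s1 s2)) /=; congr (_ + _).
  rewrite [RHS]big_mkcondr; apply: eq_bigr => i ->.
  by case: ifP; rewrite ?mulr1 ?mulr0.
by apply: eq_bigr => i /negbTE->.
Qed.

Let rest := [seq i <- s | ~~ decided p u v a c s1 s2 i].
Let U1 := U - \sum_(i <- s | decided p u v a c s1 s2 i && (0 <= s2 * v i)) u i.
Let V1 := V - \sum_(i <- s | decided p u v a c s1 s2 i && (0 <= s2 * v i)) v i.

Lemma sum_priced_decided (f : T -> R) : \sum_(i <- s) f i * x i =
  \sum_(i <- s | decided p u v a c s1 s2 i && (0 <= s2 * v i)) f i +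
  \sum_(i <- rest) f i * x i.
Proof.
rewrite -sum_decided; apply: eq_bigr => i _.
by case: ifP => // /decided_value->.
Qed.

Lemma priced_rest : priced_optimum p u v rest U1 V1 x lam mu.
Proof.
have [hx xU xV x1 x0] := best; split=> //.
  by rewrite /U1 -xU sum_priced_decided addrC addKr.
by rewrite /V1 -xV sum_priced_decided addrC addKr.
Qed.

(** Some optimal solution, namely [x], agrees with the decisions, so that any
    optimal completion of them is optimal. *)
Lemma optimal_rest (y : T -> R) : optimal2 p u v rest U1 V1 y ->
  optimal2 p u v s U V (fun i => if decided p u v a c s1 s2 i then
                                   if 0 <= s2 * v i then 1 else 0 else y i).
Proof.
move=> [hy yU yV ymax]; split.
- move=> i; case: ifP => _; last exact: hy.
  by case: ifP => _; rewrite ?ler01 lexx.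
- by rewrite sum_decided yU /U1 addrC subrK.
- by rewrite sum_decided yV /V1 addrC subrK.
move=> z hz zU zV; rewrite sum_decided.
have [_ _ _ xmax] := priced_optimum_optimal.
apply: le_trans (xmax z hz zU zV) _; rewrite sum_priced_decided lerD2l.
by have [hx xU xV _ _] := priced_rest; apply: ymax.
Qed.

End Pricing.

(** A change of basis of the two constraints, which moves all slopes u / v by
    [m]. *)
Lemma priced_shear (T : eqType) (p u v x : T -> R) s U V lam mu m :
  priced_optimum p u v s U V x lam mu ->
  priced_optimum p (fun i => u i - m * v i) v s (U - m * V) V x lam (mu + lam * m).
Proof.
move=> [hx xU xV x1 x0].
have e i : p i - lam * (u i - m * v i) - (mu + lam * m) * v i =
  p i - lam * u i - mu * v i by ring.
split=> // [|i|i]; rewrite ?e; [|exact: x1|exact: x0].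
by rewrite -xU -xV mulr_sumr -sumrB; apply: eq_bigr => i _; ring.
Qed.

Lemma optimal_shear (T : eqType) (p u v x : T -> R) s U V m :
  optimal2 p (fun i => u i - m * v i) v s (U - m * V) V x ->
  optimal2 p u v s U V x.
Proof.
have e (f : T -> R) : \sum_(i <- s) (u i - m * v i) * f i =
    \sum_(i <- s) u i * f i - m * \sum_(i <- s) v i * f i.
  by rewrite mulr_sumr -sumrB; apply: eq_bigr => i _; ring.
move=> [hx xU xV xmax]; move: xU; rewrite e xV => xU.
split=> //; first exact: addIr xU.
by move=> y hy yU yV; apply: xmax => //; rewrite e yU yV.
Qed.

End TwoConstraints.

(** * Each round decides an eighth of the items *)

Section Counting.
Variables (R : realFieldType) (T : eqType) (p u v : T -> R).
Hypothesis v0 : forall i, v i != 0.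
Variables (a c s1 s2 : R).
Hypotheses (s1E : s1 = 1 \/ s1 = -1) (s2E : s2 = 1 \/ s2 = -1).
Notation decided := (decided p u v a c s1 s2).

(** A line through a candidate [x] opposite to the quadrant avoids the quadrant
    when u / v is zero or has the sign s1 s2. *)
Lemma decided_on_line (x : R * R) i :
  p i = x.1 * u i + x.2 * v i -> 0 <= s1 * s2 * (u i * v i) ->
  0 <= s1 * (x.1 - a) -> 0 <= s2 * (x.2 - c) -> decided i.
Proof.
move=> px uv h1 h2; rewrite /decided px.
have -> : (x.1 * u i + x.2 * v i - a * u i - c * v i) * (s2 * v i) =
  s1 * (x.1 - a) * (s1 * s2 * (u i * v i)) + s2 * (x.2 - c) * (v i * v i).
  by case: s1E s2E => -> [] ->; ring.
have -> : s1 * u i * (s2 * v i) = s1 * s2 * (u i * v i) by ring.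
have vv : 0 <= v i * v i by rewrite -expr2 sqr_ge0.
by rewrite uv andbT (addr_ge0 (mulr_ge0 h1 uv) (mulr_ge0 h2 vv)).
Qed.

Lemma decided_crossing i j : u i * v i < 0 -> 0 < u j * v j ->
  0 <= s1 * ((crossing p u v (i, j)).1 - a) ->
  0 <= s2 * ((crossing p u v (i, j)).2 - c) -> decided i || decided j.
Proof.
move=> hi hj; set x := crossing _ _ _ _ => h1 h2.
have vi := v0 i; have vj := v0 j.
have slopes : u i / v i - u j / v j != 0.
  have -> : u i / v i - u j / v j =
      u i * v i / (v i * v i) - u j * v j / (v j * v j) by field; rewrite vi vj.
  have pi : 0 < v i * v i by rewrite -expr2 exprn_even_gt0.
  have pj : 0 < v j * v j by rewrite -expr2 exprn_even_gt0.
  have : u i * v i / (v i * v i) < 0 by rewrite pmulr_llt0 ?invr_gt0.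
  have : 0 < u j * v j / (v j * v j) by rewrite divr_gt0.
  by lra.
have det : u i * v j - u j * v i != 0.
  apply: contra slopes => /eqP h; rewrite subr_eq0 eqr_div //.
  by rewrite -subr_eq0 h.
have xi : p i = x.1 * u i + x.2 * v i by rewrite /x /=; field; rewrite vi vj mulNr.
have xj : p j = x.1 * u j + x.2 * v j by rewrite /x /=; field; rewrite vi vj mulNr.
(* which of the two lines avoids the quadrant depends on its orientation *)
have [hs|hs] := leP 0 (s1 * s2).
  apply/orP; right; apply: decided_on_line xj _ h1 h2.
  by rewrite mulr_ge0 // ltW.
apply/orP; left; apply: decided_on_line xi _ h1 h2.
by rewrite mulr_le0 // ltW.
Qed.

Lemma decided_flat i : u i = 0 -> 0 <= s2 * (p i / v i - c) -> decided i.
Proof.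
move=> ui h; rewrite /decided ui !mulr0 mul0r lexx andbT subr0.
have -> : (p i - c * v i) * (s2 * v i) = s2 * (p i / v i - c) * (v i * v i).
  by field.
have vv : 0 <= v i * v i by rewrite -expr2 sqr_ge0.
exact: mulr_ge0.
Qed.

End Counting.

Lemma count_zip (A B : Type) (P : pred (A * B)) (P1 Q1 : pred A) (P2 Q2 : pred B) s t :
  (forall x y, P1 x -> P2 y -> P (x, y) -> Q1 x || Q2 y) ->
  all P1 s -> all P2 t -> (count P (zip s t) <= count Q1 s + count Q2 t)%N.
Proof.
move=> h; elim: s t => [|x s IH] [|y t] //= /andP[Px /IH{}IH] /andP[Py /IH].
by have := h x y Px Py; case: (P _); case: (Q1 x); case: (Q2 y) => //=; lia.
Qed.

Lemma all_zip (A B : Type) (P : pred (A * B)) (P1 : pred A) (P2 : pred B) s t :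
  (forall x y, P1 x -> P2 y -> P (x, y)) -> all P1 s -> all P2 t ->
  all P (zip s t).
Proof.
move=> h; elim: s t => [|x s IH] [|y t] //= /andP[Px /IH{}IH] /andP[Py /IH->].
by rewrite h.
Qed.

Section Candidates.
Variables (R : realFieldType) (T : eqType) (p u v : T -> R) (s : seq T).
Hypothesis v0 : forall i, v i != 0.

Definition fallings := [seq i <- s | u i * v i < 0].
Definition risings := [seq i <- s | 0 < u i * v i].
(** A horizontal line needs no partner; the first coordinate of its candidate is
    arbitrary. *)
Definition candidates : seq (R * R) :=
  [seq crossing p u v ij | ij <- zip fallings risings] ++
  [seq (0, p i / v i) | i <- s & u i == 0].

Lemma count_by_slope (P : pred T) :
  count P s = (count P fallings + count P risings +
               count P [seq i <- s | (u i == 0)%R])%N.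
Proof.
rewrite /fallings /risings !count_filter; elim: s => //= i l ->.
have -> : (u i == 0) = (u i * v i == 0) by rewrite mulf_eq0 (negbTE (v0 i)) orbF.
by case: (ltrgt0P (u i * v i)); case: (P i); rewrite /=; lia.
Qed.

Lemma shear_sign (w : T -> R) m i :
  (w i - m * v i) * v i = (w i / v i - m) * v i ^+ 2.
Proof. by have vi := v0 i; field. Qed.

Lemma size_candidates :
  (2 * size fallings <= size s)%N -> (2 * size risings <= size s)%N ->
  (size s <= 2 * size candidates)%N.
Proof.
rewrite size_cat !size_map size_zip.
have := count_by_slope predT; rewrite !count_predT => ->.
by rewrite /minn; case: ifP; lia.
Qed.

Lemma size_candidates_leq : (size candidates <= size s)%N.
Proof.
rewrite size_cat !size_map size_zip.
have := count_by_slope predT; rewrite !count_predT => ->.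
by rewrite leq_add2r (leq_trans (geq_minl _ _)) ?leq_addr.
Qed.

Lemma crossable : all (fun ij => u ij.1 / v ij.1 != u ij.2 / v ij.2)
  (zip fallings risings).
Proof.
apply: all_zip (filter_all _ _) (filter_all _ _) => i j hi hj /=.
rewrite eqr_div //; apply/eqP => h.
have : u i * v i * (v j * v j) = u j * v j * (v i * v i).
  by transitivity (u i * v j * (v i * v j)); [ring | rewrite h; ring].
have pi : 0 < v i * v i by rewrite -expr2 exprn_even_gt0 /=.
have pj : 0 < v j * v j by rewrite -expr2 exprn_even_gt0 /=.
by nra.
Qed.

Lemma count_candidates (a c s1 s2 : R) : s1 = 1 \/ s1 = -1 -> s2 = 1 \/ s2 = -1 ->
  (count (fun x => (0 <= s1 * (x.1 - a)) && (0 <= s2 * (x.2 - c)))%R candidates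
   <= count (decided p u v a c s1 s2) s)%N.
Proof.
move=> s1E s2E; rewrite (count_by_slope (decided _ _ _ _ _ _ _)).
rewrite count_cat !count_map; apply: leq_add.
  apply: count_zip (filter_all _ _) (filter_all _ _) => i j hi hj /andP[h1 h2].
  exact: (decided_crossing v0 s1E s2E hi hj h1 h2).
rewrite !count_filter; apply: sub_count => i /andP[/andP[_ h] /eqP ui].
by rewrite /= ui eqxx andbT; apply: decided_flat.
Qed.

(** Halving the candidates at the median of either coordinate keeps those on
    the far side from the optimal prices. *)
Lemma size_beyond (l : seq (R * R)) (f : R * R -> R) t sg :
  sg = 1 \/ sg = -1 ->
  (size l <= 2 * count (fun x => (f x <= t)%R) l)%N ->
  (size l <= 2 * count (fun x => (t <= f x)%R) l)%N ->
  (size l <= 2 * count (fun x => (0 <= sg * (f x - t))%R) l)%N.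
Proof.
move=> [->|->] h1 h2.
  apply: leq_trans h2 _; rewrite leq_mul2l; apply/orP; right.
  by apply: sub_count => x /=; rewrite mul1r subr_ge0.
apply: leq_trans h1 _; rewrite leq_mul2l; apply/orP; right.
by apply: sub_count => x /=; rewrite mulN1r opprB subr_ge0.
Qed.

End Candidates.

Section Solve.
Variable R : realFieldType.
Notation ev := (ev fns).

Lemma ev_median : exists K, forall l : seq (R * R), all (fun x => x.2 == 1) l ->
  exists t, [/\ ev (size l) [:: points l] (fun=> median_fn) (VNum t) K 0,
    (size l <= 2 * count (fun x => (x.1 <= t)%R) l)%N &
    (size l <= 2 * count (fun x => (t <= x.1)%R) l)%N].
Proof.
have [K hK] := ev_select R; eexists => l l1.
have l0 : all (fun x => 0 <= x.2) l by apply: sub_all l1 => z /eqP->.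
have hl : 0 <= (\sum_(x <- l) x.2) / 2%:R <= \sum_(x <- l) x.2.
  by have := sum_weights_ge0 xpredT l0; lra.
have [t et ht] := hK l _ l0 hl; have [h1 h2] := splits_median l1 ht.
exists t; split=> //; eapply ev_fn; eapply (ev_leq (leqnn _) (leqnn _)); last first.
  eapply ev_use; [reflexivity | | exact: et | ]; first by [].
  eapply ev_cons; last by evs.
  eapply ev_div; [ | by evs | by rewrite pnatr_eq0].
  by eapply ev_use; [reflexivity | | exact: (ev_total l) | evs].
by [].
Qed.


Lemma ev_round : exists K, forall (T : eqType) (p u v : T -> R) s U V,
  (0 < size s)%N -> (forall i, v i != 0) -> attainable s v V ->
  (forall m, attainable s (fun i => u i - m * v i) (U - m * V)) ->
  exists m a c s1 s2 res1 res2,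
    let u' := fun i => u i - m * v i in let U' := U - m * V in
    let dec := decided p u' v a c s1 s2 in
  [/\ verdict (fun i => p i - a * u' i) v u' s V U' s1 res1,
      verdict (fun i => p i - c * v i) u' v s U' V s2 res2,
      s1 = 1 \/ s1 = -1 -> s2 = 1 \/ s2 = -1 -> (size s <= 8 * count dec s)%N
    & forall x r,
      (0 < s1 * s1 -> 0 < s2 * s2 -> ev 0 [:: VCons (VCons
          (VNum (U' - \sum_(i <- s | dec i && (0 <= s2 * v i)) u' i))
          (VNum (V - \sum_(i <- s | dec i && (0 <= s2 * v i)) v i)))
          (items p u' v [seq i <- s | ~~ dec i])] (fun=> solve_fn)
        (nums [seq x i | i <- s & ~~ dec i]) 0 r) ->
      ev (size s) [:: VCons (VCons (VNum U) (VNum V)) (items p u v s)]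
        (fun=> solve_fn)
        (if s1 * s1 <= 0 then res1 else if s2 * s2 <= 0 then res2 else
         nums [seq if dec i then if 0 <= s2 * v i then 1 else 0 else x i
              | i <- s]) K r].
Proof.
have [Km hm] := ev_median; have [Kt ht] := @ev_test R.
eexists => T p u v s U V s_gt0 v0 attV attU.
have [|m [em m_le m_ge]] := hm [seq (u i / v i, 1) | i <- s].
  by rewrite all_map; apply/allP => i _ /=.
set u' := fun i => u i - m * v i; set U' := U - m * V.
have attU' : attainable s u' U' by exact: attU.
pose pts := candidates p u' v s.
have [|a [ea a_le a_ge]] := hm [seq (x.1, 1) | x <- pts].
  by rewrite all_map; apply/allP => i _ /=.
have [s1 [res1 [e1 ver1]]] := ht T (fun i => p i - a * u' i) v u' s V U' attV.
pose pts' := [seq x <- pts | 0 <= s1 * (x.1 - a)].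
have [|c [ec c_le c_ge]] := hm [seq (x.2, 1) | x <- pts'].
  by rewrite all_map; apply/allP => i _ /=.
have [s2 [res2 [e2 ver2]]] := ht T (fun i => p i - c * v i) u' v s U' V attU'.
exists m, a, c, s1, s2, res1, res2; split=> //.
  move=> s1E s2E; rewrite !size_map !count_map in m_le m_ge a_le a_ge c_le c_ge.
  have v2 i : 0 < v i ^+ 2 by rewrite exprn_even_gt0 //= v0.
  have fall2 : (2 * size (fallings u' v s) <= size s)%N.
    rewrite size_filter; have := count_predC (fun i => m <= u i / v i) s.
    rewrite (@eq_count _ (fun i => u' i * v i < 0) (predC (fun i => m <= u i / v i))).
      have {}m_ge : (size s <= 2 * count (fun i => m <= u i / v i)%R s)%N by [].
      by lia.
    by move=> i; rewrite /= -ltNge shear_sign // pmulr_llt0 ?subr_lt0 // v2.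
  have rise2 : (2 * size (risings u' v s) <= size s)%N.
    rewrite size_filter; have := count_predC (fun i => u i / v i <= m) s.
    rewrite (@eq_count _ (fun i => 0 < u' i * v i) (predC (fun i => u i / v i <= m))).
      have {}m_le : (size s <= 2 * count (fun i => u i / v i <= m)%R s)%N by [].
      by lia.
    by move=> i; rewrite /= -ltNge shear_sign // pmulr_lgt0 ?subr_gt0 // v2.
  have n1 := size_candidates p v0 fall2 rise2.
  have n2 := size_beyond s1E a_le a_ge.
  have n3 := size_beyond s2E c_le c_ge.
  have n4 := count_candidates p u' s v0 a c s1E s2E.
  rewrite -size_filter -/pts' in n2; rewrite count_filter in n3.
  have {}n3 := leq_trans n3 (leq_mul (leqnn 2) (leq_trans _ n4)).
  have {}n3 : (size pts' <= 2 * count (decided p u' v a c s1 s2) s)%N.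
    by apply: n3; apply: sub_count => y /= /andP[-> ->].
  have n5 : (size s <= 2 * size pts)%N by exact: n1.
  have n6 : (size pts <= 2 * size pts')%N by exact: n2.
  by rewrite -/u'; lia.
move=> x r hrec.
have size_pts : (size pts <= size s)%N by exact: size_candidates_leq.
have size_pts' : (size pts' <= size s)%N.
  by apply: leq_trans (size_filter_leq _ _) size_pts.
have size_f (P : pred T) : (size [seq i <- s | P i] <= size s)%N.
  exact: size_filter_leq.
have [i0 [s0 sE]] : exists i0 s0, s = i0 :: s0.
  by case: (s) s_gt0 => // i0 s0; exists i0, s0.
eapply ev_fn; eapply (ev_leq (leqnn _)); last first.
  eapply ev_match_cons.
    by eapply ev_eq; [evs | rewrite {1}sE; reflexivity].
  eapply ev_let.
    eapply ev_use; [reflexivity | | exact: em | ]; first by rewrite size_map.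
    by eapply ev_use; [reflexivity | | exact: (ev_slopes p u s v0) | evs].
  eapply ev_let.
    by eapply ev_use; [reflexivity | | exact: (ev_shear p u v m s) | evs].
  rewrite -/u'; eapply ev_let; first by evs.
  rewrite -/U'; eapply ev_let; first by evs.
  eapply (ev_let (u := points pts)).
    eapply ev_use; [reflexivity | | exact: (ev_crossings p
      [seq (0, p i / v i) | i <- s & u' i == 0] v0 (crossable u' s v0)) | ].
      by rewrite size_zip (leq_trans (geq_minl _ _)) // size_f.
    eapply ev_cons.
      by eapply ev_use; [reflexivity | | exact: (ev_level p u' s v0) | evs].
    eapply ev_use; [reflexivity | | exact: (ev_zip_pairs p u' v) | ].
      exact: size_f.
    eapply ev_cons.
      by eapply ev_use; [reflexivity | | exact: (ev_falling p u' v s) | evs].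
    by eapply ev_use; [reflexivity | | exact: (ev_rising p u' v s) | evs].
  eapply ev_let.
    eapply ev_use; [reflexivity | | exact: ea | ]; first by rewrite size_map.
    by eapply ev_use; [reflexivity | exact: size_pts | exact: (ev_firsts pts) | evs].
  eapply ev_let.
    eapply ev_use; [reflexivity | | exact: e1 | ]; first by [].
    eapply ev_cons; first by evs.
    by eapply ev_use; [reflexivity | | exact: (ev_price_u p u' v a s) | evs].
  eapply ev_if_both; [by evs | by evs | move=> hs1; rewrite hs1; by evs | move=> hs1].
  rewrite leNgt hs1 /=; eapply ev_let.
    by eapply ev_use; [reflexivity | exact: size_pts | exact: (ev_beyond s1 a pts) | evs].
  eapply ev_let.
    eapply ev_use; [reflexivity | | exact: ec | ]; first by rewrite size_map.
    by eapply ev_use; [reflexivity | exact: size_pts' | exact: (ev_seconds pts') | evs].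
  eapply ev_let.
    eapply ev_use; [reflexivity | | exact: e2 | ]; first by [].
    eapply ev_cons; first by evs.
    by eapply ev_use; [reflexivity | | exact: (ev_price_v p u' v c s) | evs].
  eapply ev_if_both; [by evs | by evs | move=> hs2; rewrite hs2; by evs | move=> hs2].
  rewrite leNgt hs2 /=; eapply ev_let; first by evs.
  eapply ev_let.
    eapply ev_call; [reflexivity | | exact: ev_widen (hrec hs1 hs2)].
    eapply ev_cons.
      eapply ev_cons.
        eapply ev_sub; first by evs.
        by eapply ev_use; [reflexivity | | exact: (ev_fixed_u p u' v a c s1 s2 s) | evs].
      eapply ev_sub; first by evs.
      by eapply ev_use; [reflexivity | | exact: (ev_fixed_v p u' v a c s1 s2 s) | evs].
    by eapply ev_use; [reflexivity | | exact: (ev_undecided p u' v a c s1 s2 s) | evs].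
  by eapply ev_use; [reflexivity | | exact: (ev_merge p u' v a c s1 s2 x s) | evs].
- by rewrite !(add0n, addn0).
- by [].
Qed.

(** Each round leaves at most 7/8 of the items to the recursive call, so the
    rounds cost a geometric series. *)
Lemma ev_solve : exists K, forall (T : eqType) (p u v : T -> R) s U V,
  (forall i, v i != 0) ->
  (exists x lam mu, priced_optimum p u v s U V x lam mu) ->
  exists2 x, ev (size s) [:: VCons (VCons (VNum U) (VNum V)) (items p u v s)]
    (fun=> solve_fn) (nums [seq x i | i <- s]) K 0 & optimal2 p u v s U V x.
Proof.
have [k hk] := ev_round; exists (16 * k + 20)%N => T p u v s U V v0.
have [n] := ubnP (size s); elim: n s p u U V => // n IH s p u U V sn [x [lam [mu opt]]].
have [s0|s_gt0] := posnP (size s).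
  exists x; last exact: priced_optimum_optimal opt.
  rewrite (size0nil s0); eapply ev_fn; eapply (ev_leq (leqnn _)); last first.
  - by eapply ev_match_nil; evs.
  - by [].
  - by rewrite (leq_trans _ (leq_addl _ _)).
have att (f : T -> R) : attainable s f (\sum_(i <- s) f i * x i).
  by have [hx _ _ _ _] := opt; exact: box_attainable.
have attV : attainable s v V by have [_ _ <- _ _] := opt; exact: att.
have optm m := priced_shear m opt.
have attU m : attainable s (fun i => u i - m * v i) (U - m * V).
  by have [_ <- _ _ _] := optm m; exact: att.
have [m [a [c [s1 [s2 [res1 [res2]]]]]]] := hk T p u v s U V s_gt0 v0 attV attU.
move: (optm m) => {att attV attU opt optm}.
move: (mu + lam * m) => {}mu; set u' := fun i => u i - m * v i.
set U' := U - m * V => opt /= [ver1 ver2 dec_ge run].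
case: ver1 => [[s1E [y res1E opty]]|[s1E side1]].
  exists y; last exact: optimal_shear (optimal_with_u opty).
  have := run x 0%N; rewrite s1E mul0r ltxx lexx res1E => {}run.
  by apply: (ev_leq (leqnn _) _ _ (run _)) => //; lia.
case: ver2 => [[s2E [y res2E opty]]|[s2E side2]].
  exists y; last exact: optimal_shear (optimal_with_v opty).
  have := run x 0%N; rewrite s2E mul0r ltxx lexx res2E => {}run.
  have {}run := run (fun _ h => False_ind _ (notF h)).
  rewrite leNgt in run; have s11 : 0 < s1 * s1 by case: s1E => ->; lra.
  by rewrite s11 /= in run; apply: (ev_leq (leqnn _) _ _ run) => //; lia.
have h1 := priced_points_u opt side1; have h2 := priced_points_v opt side2.
have opt_rest := priced_rest opt v0 s1E s2E h1 h2.
have {}dec_ge := dec_ge s1E s2E.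
set dec := decided p u' v a c s1 s2 in dec_ge run opt_rest.
have size_rest : (size [seq i <- s | ~~ dec i] + count dec s = size s)%N.
  by rewrite size_filter addnC count_predC.
have [|y ey opty] := IH _ p u' _ _ _ (ex_intro _ x (ex_intro _ lam (ex_intro _ mu opt_rest))).
  by lia.
exists (fun i => if dec i then if 0 <= s2 * v i then 1 else 0 else y i); last first.
  exact: optimal_shear (optimal_rest opt v0 s1E s2E h1 h2 opty).
have [r hr er] := ev_own ey.
have := run y r (fun _ _ => er).
have -> : s1 * s1 <= 0 = false by case: s1E => ->; apply/negbTE; lra.
have -> : s2 * s2 <= 0 = false by case: s2E => ->; apply/negbTE; lra.
move=> [t e ht]; exists t => //; apply: leq_trans ht _.
have : (8 * (size [seq i <- s | ~~ dec i]) <= 7 * size s)%N by lia.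
move: hr s_gt0; move: (size _) (size s) => n' N hr N0 hN.
rewrite !addn0 in hr *.
have : (k * (8 * n') <= k * (7 * N))%N by rewrite leq_mul2l hN orbT.
have : (k * 1 <= k * N)%N by rewrite leq_mul2l N0 orbT.
by lia.
Qed.

End Solve.

(** * Optimal prices *)

Section Prices.
Variable R : realFieldType.

Lemma between (lo up : seq R) :
  (forall x y, x \in lo -> y \in up -> x <= y) ->
  exists m, (forall x, x \in lo -> x <= m) /\ (forall y, y \in up -> m <= y).
Proof.
elim: lo => [|l lo IH] h.
  elim: up {h} => [|y up [m [_ hm]]]; first by exists 0.
  exists (Num.min y m); split=> // z; rewrite inE => /orP[/eqP->|/hm].
    by rewrite ge_min lexx.
  by rewrite ge_min orbC => ->.
have [|m [hlo hup]] := IH.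
  by move=> x y xlo; apply: h; rewrite inE xlo orbT.
exists (Num.max l m); split=> z.
  by rewrite inE le_max => /orP[/eqP->|/hlo->]; rewrite ?lexx ?orbT.
by move=> zup; rewrite ge_max hup // h // inE eqxx.
Qed.

Lemma solvable1 (C : seq (R * R)) :
  (forall x, x \in C -> x.1 = 0 -> 0 <= x.2) ->
  (forall x y, x \in C -> y \in C -> 0 < x.1 -> y.1 < 0 ->
     0 <= - y.1 * x.2 + x.1 * y.2) ->
  exists m, forall x, x \in C -> x.1 * m <= x.2.
Proof.
move=> h0 hpair.
have [|m [hlo hup]] := @between [seq x.2 / x.1 | x <- C & x.1 < 0]
                                [seq x.2 / x.1 | x <- C & 0 < x.1].
  move=> _ _ /mapP[y + ->] /mapP[x + ->].
  rewrite !mem_filter => /andP[y0 yC] /andP[x0 xC].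
  rewrite ler_pdivlMr // mulrAC ler_ndivrMr //.
  by have := hpair x y xC yC x0 y0; lra.
exists m => x xC; case: (ltrgt0P x.1) => hx.
- by rewrite mulrC -ler_pdivlMr // hup //; apply/mapP; exists x; rewrite ?mem_filter ?hx.
- by rewrite mulrC -ler_ndivrMr // hlo //; apply/mapP; exists x; rewrite ?mem_filter ?hx.
- by rewrite hx mul0r h0.
Qed.

(** The theorem of alternatives in two unknowns, by Fourier-Motzkin
    elimination.  The inequalities a l + b m <= c are taken from a convex cone
    [K] that contains all their nonnegative combinations. *)
Lemma solvable2 (K : R -> R -> R -> Prop) :
  (forall a b c a' b' c', K a b c -> K a' b' c' -> K (a + a') (b + b') (c + c')) ->
  (forall t a b c, 0 <= t -> K a b c -> K (t * a) (t * b) (t * c)) ->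
  (forall c, K 0 0 c -> 0 <= c) ->
  forall C : seq (R * R * R), (forall x, x \in C -> K x.1.1 x.1.2 x.2) ->
  exists l m, forall x, x \in C -> x.1.1 * l + x.1.2 * m <= x.2.
Proof.
move=> Kadd Kscale K0 C CK.
have Kcomb t t' a b c a' b' c' a'' b'' c'' : K a b c -> K a' b' c' ->
    0 <= t -> 0 <= t' -> a'' = t * a + t' * a' -> b'' = t * b + t' * b' ->
    c'' = t * c + t' * c' -> K a'' b'' c''.
  by move=> h h' t0 t'0 -> -> ->; apply: Kadd; exact: Kscale.
pose C1 := [seq (x.1.2, x.2) | x <- C & x.1.1 == 0] ++
  [seq (- y.1.1 * x.1.2 + x.1.1 * y.1.2, - y.1.1 * x.2 + x.1.1 * y.2) |
    x <- [seq x <- C | 0 < x.1.1], y <- [seq y <- C | y.1.1 < 0]].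
have C1K z : z \in C1 -> K 0 z.1 z.2.
  rewrite mem_cat => /orP[/mapP[x + ->]|/allpairsP[[x y] /= [+ + ->]]].
    by rewrite mem_filter => /andP[/eqP<- /CK].
  rewrite !mem_filter => /andP[x0 /CK Kx] /andP[y0 /CK Ky].
  apply: (Kcomb (- y.1.1) x.1.1 _ _ _ _ _ _ _ _ _ Kx Ky) => //=; last by ring.
    by rewrite oppr_ge0 ltW.
  exact: ltW.
have [x xC x0|x y xC yC x0 y0|m hm] := @solvable1 C1.
- by apply: K0; have := C1K x xC; rewrite x0.
- apply: K0; apply: (Kcomb (- y.1) x.1 _ _ _ _ _ _ _ _ _ (C1K x xC) (C1K y yC)) => //.
  + by rewrite oppr_ge0 ltW.
  + exact: ltW.
  + by ring.
  + by ring.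
have hm1 x : x \in C -> x.1.1 = 0 -> x.1.2 * m <= x.2.
  move=> xC x0; apply: (hm (x.1.2, x.2)); rewrite mem_cat; apply/orP; left.
  by apply/mapP; exists x; rewrite // mem_filter x0 eqxx.
have hm2 x y : x \in C -> y \in C -> 0 < x.1.1 -> y.1.1 < 0 ->
    (- y.1.1 * x.1.2 + x.1.1 * y.1.2) * m <= - y.1.1 * x.2 + x.1.1 * y.2.
  move=> xC yC x0 y0; apply: (hm (_, _)); rewrite mem_cat; apply/orP; right.
  by apply/allpairsP; exists (x, y); rewrite /= !mem_filter x0 y0 xC yC.
have [_ /mapP[x xC ->] /= x0|_ _ /mapP[x xC ->] /mapP[y yC ->] /= x0 y0|l hl] :=
  @solvable1 [seq (x.1.1, x.2 - x.1.2 * m) | x <- C].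
- by rewrite subr_ge0 hm1.
- by have := hm2 x y xC yC x0 y0; lra.
exists l, m => x xC; have := hl _ (map_f (fun x => (x.1.1, x.2 - x.1.2 * m)) xC).
by rewrite /= lerBrDr.
Qed.

(** The cone is that of the changes of the two constraints and of the
    objective along feasible directions k (y - x) of the box; a capacity that
    is not exhausted does not restrict the direction.  Moving a single
    coordinate to 0 or 1 gives the complementary slackness conditions. *)
Lemma optimal_prices (T : eqType) (p w g x : T -> R) (s : seq T) (b V : R) :
  uniq s -> box x -> \sum_(i <- s) w i * x i <= b -> \sum_(i <- s) g i * x i = V ->
  (forall y, box y -> \sum_(i <- s) w i * y i <= b -> \sum_(i <- s) g i * y i = V ->
     \sum_(i <- s) p i * y i <= \sum_(i <- s) p i * x i) ->
  exists l m, [/\ 0 <= l, \sum_(i <- s) w i * x i < b -> l = 0 &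
    forall i, i \in s -> (1 - x i) * (p i - l * w i - m * g i) <= 0 /\
                         0 <= x i * (p i - l * w i - m * g i)].
Proof.
move=> s_uniq hx xb xV xmax.
pose sum (f y : T -> R) := \sum_(i <- s) f i * y i.
have sumE f y : \sum_(i <- s) f i * y i = sum f y by [].
have sum_lin f y z t t' :
    sum f (fun i => t * y i + t' * z i) = t * sum f y + t' * sum f z.
  by rewrite /sum !mulr_sumr -big_split; apply: eq_bigr => i _ /=; ring.
have box_lin y z t t' : 0 <= t -> 0 <= t' -> t + t' = 1 -> box y -> box z ->
    box (fun i => t * y i + t' * z i).
  move=> t0 t'0 tt' hy hz i; have /andP[? ?] := hy i; have /andP[? ?] := hz i.
  by apply/andP; split; nra.
pose K a bb c := exists k y, [/\ 0 <= k, box y, bb = - (k * (sum g y - sum g x)),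
  c = - (k * (sum p y - sum p x)) & sum w x = b -> k * (sum w y - sum w x) <= - a].
have Kadd a bb c a' b' c' : K a bb c -> K a' b' c' -> K (a + a') (bb + b') (c + c').
  move=> [k [y [k0 hy -> -> hw]]] [k' [y' [k'0 hy' -> -> hw']]].
  have [kk|kk] := eqVneq (k + k') 0.
    have k_eq0 : k = 0 by lra.
    have k'_eq0 : k' = 0 by lra.
    rewrite k_eq0 in hw *; rewrite k'_eq0 in hw' *.
    exists 0, x; split=> //; [by ring | by ring | move=> e].
    by have := hw e; have := hw' e; lra.
  have kk0 : 0 < k + k' by rewrite lt_neqAle eq_sym kk addr_ge0.
  have comb f : (k + k') * (sum f (fun i => k / (k + k') * y i + k' / (k + k') * y' i)
      - sum f x) = k * (sum f y - sum f x) + k' * (sum f y' - sum f x).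
    by rewrite sum_lin; field.
  exists (k + k'), (fun i => k / (k + k') * y i + k' / (k + k') * y' i).
  rewrite !comb; split; [exact: addr_ge0 | | by ring | by ring | move=> e].
    apply: box_lin => //; [by rewrite divr_ge0 // ltW | by rewrite divr_ge0 // ltW | by field].
  by have := hw e; have := hw' e; lra.
have Kscale t a bb c : 0 <= t -> K a bb c -> K (t * a) (t * bb) (t * c).
  move=> t0 [k [y [k0 hy -> -> hw]]]; exists (t * k), y.
  split=> //; [exact: mulr_ge0 | by ring | by ring | move=> e].
  by rewrite -mulrA -mulrN; apply: ler_wpM2l => //; exact: hw.
have K0 c : K 0 0 c -> 0 <= c.
  move=> [k [y [k0 hy eg -> hw]]]; rewrite oppr_ge0.
  have [->|kn0] := eqVneq k 0; first by rewrite mul0r.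
  have {}k0 : 0 < k by rewrite lt_neqAle eq_sym kn0.
  have yV : sum g y = V.
    move/esym/eqP: eg; rewrite oppr_eq0 mulf_eq0 (negbTE kn0) subr_eq0 /= => /eqP->.
    exact: xV.
  rewrite pmulr_rle0 // subr_le0.
  have [wx|wx] := eqVneq (sum w x) b.
    by apply: xmax => //; have := hw wx; rewrite oppr0 pmulr_rle0 // subr_le0 -wx.
  have {}wx : sum w x < b by rewrite lt_neqAle wx.
  have [wy|wy] := leP (sum w y) b; first exact: xmax.
  (* the segment from x to y leaves the half-space of the capacity here *)
  pose e := (b - sum w x) / (sum w y - sum w x).
  have d0 : 0 < sum w y - sum w x by lra.
  have e0 : 0 < e by rewrite divr_gt0 // subr_gt0.
  have e1 : e <= 1 by rewrite ler_pdivrMr // mul1r; lra.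
  have : sum p (fun i => e * y i + (1 - e) * x i) <= sum p x.
    apply: xmax; [apply: box_lin => //; lra | | ].
      rewrite sumE sum_lin; have -> : e * sum w y + (1 - e) * sum w x =
        e * (sum w y - sum w x) + sum w x by ring.
      by rewrite divfK ?gt_eqF // subrK.
    by rewrite sumE sum_lin yV (xV : sum g x = V); ring.
  by rewrite sum_lin; nra.
pose move_to (i : T) (t : R) j := if j == i then t else x j.
have sum_move f i t : i \in s -> sum f (move_to i t) - sum f x = f i * (t - x i).
  move=> si; rewrite /sum !(bigD1_seq i si s_uniq) /= /move_to eqxx.
  rewrite (eq_bigr (fun j => f j * x j)) => [|j /negbTE->] //; by ring.
have box_move i t : 0 <= t <= 1 -> box (move_to i t).
  by move=> ht j; rewrite /move_to; case: ifP => _; [exact: ht | exact: hx].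
pose C := (if sum w x < b then [:: (1, 0, 0)] else [::]) ++ (-1, 0, 0) ::
  [seq (- ((1 - x i) * w i), - ((1 - x i) * g i), - ((1 - x i) * p i)) | i <- s] ++
  [seq (x i * w i, x i * g i, x i * p i) | i <- s].
have [z|l [m hlm]] := solvable2 Kadd Kscale K0 (C := C).
  rewrite mem_cat inE mem_cat => /or4P[|/eqP->|/mapP[i si ->]|/mapP[i si ->]] /=.
  - case: ifP => //; rewrite inE => wx /eqP-> /=.
    exists 0, x; split=> //; try by ring.
    by move=> e; rewrite e ltxx in wx.
  - exists 0, x; split=> //; try by ring.
    by move=> _; lra.
  - exists 1, (move_to i 1); rewrite !sum_move //; split=> //; try by ring.
      by apply: box_move; rewrite ler01 lexx.
    by move=> _; lra.
  - exists 1, (move_to i 0); rewrite !sum_move //; split=> //; try by ring.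
      by apply: box_move; rewrite ler01 lexx.
    by move=> _; lra.
have memC z : z \in (-1, 0, 0) ::
  [seq (- ((1 - x i) * w i), - ((1 - x i) * g i), - ((1 - x i) * p i)) | i <- s] ++
  [seq (x i * w i, x i * g i, x i * p i) | i <- s] -> z \in C.
  by rewrite [z \in C]mem_cat => ->; rewrite orbT.
have l0 : 0 <= l.
  have := hlm (-1, 0, 0); rewrite memC ?inE ?eqxx //= => /(_ isT).
  by rewrite mulN1r mul0r addr0 oppr_le0.
exists l, m; split=> // [wx|i si].
  apply/eqP; rewrite eq_le l0 andbT; have := hlm (1, 0, 0).
  by rewrite /C sumE in wx *; rewrite wx inE eqxx /= => /(_ isT); rewrite mul1r mul0r addr0.
split.
  have /= := hlm (- ((1 - x i) * w i), - ((1 - x i) * g i), - ((1 - x i) * p i)).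
  rewrite memC => [/(_ isT)|]; first by lra.
  rewrite inE mem_cat; apply/or3P/Or32.
  exact: (map_f (fun i => (- ((1 - x i) * w i), - ((1 - x i) * g i), - ((1 - x i) * p i)))).
have /= := hlm (x i * w i, x i * g i, x i * p i).
rewrite memC => [/(_ isT)|]; first by lra.
rewrite inE mem_cat; apply/or3P/Or33.
exact: (map_f (fun i => (x i * w i, x i * g i, x i * p i))).
Qed.

End Prices.

(** * The colored knapsack instance *)

Section Main.
Variable R : realFieldType.
Notation ev := (ev fns).

Lemma sum_enum n (f : 'I_n -> R) : \sum_(i <- enum 'I_n) f i = \sum_i f i.
Proof. by rewrite big_enum. Qed.

Lemma sum_color_sign n m (I : ckp n m) (c : 'I_m) (x : 'I_n -> R) :
  \sum_i color_sign R I c i * x i = color_excess I x c.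
Proof.
rewrite /color_excess /color_sum (bigID (fun i => color I i == c)) /=.
rewrite -sumrN; congr (_ + _); apply: eq_bigr => i h; rewrite /color_sign.
  by rewrite h mul1r.
by rewrite (negbTE h) mulN1r.
Qed.

(** If the excess of one color is 1, then the other colors are in the
    minority, so that their constraints hold. *)
Lemma critical_lp_feasible_ckp n m (I : ckp n m) (c : 'I_m) (x : 'I_n -> R) :
  critical_lp_feasible I c x -> lp_ckp_feasible I x.
Proof.
move=> [hw hc hx]; split=> // c'; rewrite sum_color_sign in hc.
have [->|cc] := eqVneq c' c; first by rewrite hc.
have x0 i : 0 <= x i by have /andP[] := hx i.
have h1 : color_sum I x c' <= \sum_(i | color I i != c) x i.
  rewrite /color_sum big_mkcond [leRHS]big_mkcond; apply: ler_sum => i _.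
  case: (eqVneq (color I i) c') => [->|_]; first by rewrite cc.
  by case: ifP.
have h2 : color_sum I x c <= \sum_(i | color I i != c') x i.
  rewrite /color_sum big_mkcond [leRHS]big_mkcond; apply: ler_sum => i _.
  case: (eqVneq (color I i) c) => [->|_]; first by rewrite eq_sym cc.
  by case: ifP.
by move: hc; rewrite /color_excess; lra.
Qed.

Lemma ev_main : exists K, forall n m (I : ckp n m) (c : 'I_m),
  (exists x : 'I_n -> R, profit_maximal I (critical_lp_feasible I c) x) ->
  exists2 x : 'I_n -> R, ev n [:: encode_input R I c] (fun=> main_code)
      (encode_solution x) K 0 & profit_maximal I (critical_lp_feasible I c) x.
Proof.
have [Kl hl] := @ev_lexopt R; have [Ks hs] := @ev_solve R.
eexists => n m I c [z [[zw zc zx] zmax]].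
pose p i : R := (profit I i)%:~R; pose w i : R := (weight I i)%:~R.
pose g := color_sign R I c; pose s := enum 'I_n; pose b : R := (capacity I)%:~R.
have size_s : size s = n by rewrite size_enum_ord.
have g0 i : g i != 0.
  by rewrite /g /color_sign; case: ifP => _; rewrite ?oppr_eq0 oner_eq0.
have zS : \sum_(i <- s) g i * z i = 1 by rewrite sum_enum.
have attg : attainable s g 1 by rewrite -zS; exact: box_attainable.
have [y ey [hy yS ymax ylex]] :=
  hl _ (fun i => p i - 0 * w i) g (fun i => - w i) s 1 attg.
have pE (f : 'I_n -> R) : \sum_(i <- s) (p i - 0 * w i) * f i = total_profit I f.
  by rewrite sum_enum; apply: eq_bigr => i _; rewrite mul0r subr0.
pose W := \sum_(i <- s) w i * y i.
have [x' solved] : exists x' : 'I_n -> R, b < W ->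
    [/\ ev (size s) [:: VCons (VCons (VNum b) (VNum 1)) (items p w g s)]
          (fun=> solve_fn) (nums [seq x' i | i <- s]) Ks 0,
        optimal2 p w g s b 1 x' & \sum_(i <- s) w i * z i = b].
  have [bW|] := ltP b W; last by exists z.
  have [l [mu [l0 lslack lmu]]] : exists l mu, [/\ 0 <= l,
      \sum_(i <- s) w i * z i < b -> l = 0 & forall i, i \in s ->
      (1 - z i) * (p i - l * w i - mu * g i) <= 0 /\
      0 <= z i * (p i - l * w i - mu * g i)].
    apply: (@optimal_prices _ _ p w g z s b 1) => //.
    - exact: enum_uniq.
    - by rewrite sum_enum.
    - move=> t ht tw tg; rewrite !sum_enum; apply: zmax.
      by split=> //; rewrite /within_capacity -sum_enum.
  have zopt U : \sum_(i <- s) w i * z i = U ->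
      priced_optimum p w g s U 1 z l mu.
    move=> zU; split=> // i r0; have [h1 h2] := lmu i (mem_enum _ i).
      by have /andP[_ z1] := zx i; apply/le_anti; rewrite z1 /=; nra.
    by have /andP[z0 _] := zx i; apply/le_anti; rewrite z0 andbT; nra.
  (* otherwise z is optimal without capacity, and y is at most as heavy as z *)
  have l_gt0 : l != 0.
    apply/eqP => l_eq0; have := zopt _ erefl; rewrite l_eq0 => opt.
    have zfree t : box t -> \sum_(i <- s) g i * t i = 1 ->
        total_profit I t <= total_profit I z.
      move=> ht tS; have := priced_max opt ht; rewrite !sum_priced zS tS.
      by rewrite !mul0r !subr0 lerD2r !sum_enum.
    have : \sum_(i <- s) - w i * z i <= \sum_(i <- s) - w i * y i.
      by apply: ylex => //; rewrite !pE; exact: zfree.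
    under eq_bigr do rewrite mulNr; under [leRHS]eq_bigr do rewrite mulNr.
    rewrite !sumrN lerN2 leNgt => /negP; apply; apply: le_lt_trans bW.
    by rewrite sum_enum.
  have zb : \sum_(i <- s) w i * z i = b.
    apply/eqP; rewrite eq_le {1}sum_enum zw /= leNgt; apply/negP => /lslack h.
    by rewrite h eqxx in l_gt0.
  have [|x' ex' ox'] := hs _ p w g s b 1 g0.
    by exists z, l, mu; exact: zopt.
  by exists x'.
pose x := if W <= b then y else x'; exists x; last first.
  rewrite /x; case: leP => [Wb|/solved[_ [hx' xw xg xmax] zb]].
    split=> [|t [tw tg ht]]; last by rewrite -!pE; apply: ymax; rewrite ?sum_enum.
    by split=> //; [rewrite /within_capacity -sum_enum | rewrite -sum_enum].
  split=> [|t /zmax tz].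
    by split=> //; [rewrite /within_capacity -sum_enum xw | rewrite -sum_enum].
  apply: le_trans tz _; rewrite /total_profit -!sum_enum; exact: xmax.
rewrite -{1}size_s; eapply ev_fn; eapply (ev_leq (leqnn _)); last first.
  eapply ev_let.
    eapply ev_use; [reflexivity | | exact: (ev_parse p w (fun i => color I i) c s) | ].
      by [].
    by evs.
  eapply ev_let.
    eapply ev_use; [reflexivity | | exact: (ev_price_u p w g 0 s) | ].
      by [].
    by evs.
  eapply ev_let.
    eapply ev_use; [reflexivity | | exact: ey | ].
      by [].
    eapply ev_cons; first by evs.
    by eapply ev_use; [reflexivity | | exact: (ev_negate (fun i => p i - 0 * w i) g w s) | evs].
  eapply ev_if_both.
  - eapply ev_use; [reflexivity | | exact: (ev_dot (fun i => p i - 0 * w i) g w y s) | ]; first by [].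
    eapply ev_cons; first by evs.
    by eapply ev_use; [reflexivity | | exact: (ev_zip_items (fun i => p i - 0 * w i) g w y s) | evs].
  - by evs.
  - move=> Wb; rewrite /x /W Wb; eapply ev_eq; first by evs.
    by rewrite /nums /encode_solution -map_comp.
  - rewrite -/W => bW; have [ex' _ _] := solved bW.
    rewrite /x leNgt bW /=; eapply ev_eq; last first.
      by rewrite /encode_solution map_comp; reflexivity.
    by eapply ev_use; [reflexivity | | exact: ex' | evs].
- by [].
- by [].
Qed.

End Main.

Theorem proposition1 (R : realFieldType) :
  exists (P : program) (C : nat),
    forall (n m : nat) (I : ckp n m) (c : 'I_m),
      (exists x : 'I_n -> R,
         profit_maximal I (lp_ckp_feasible I) x /\ critical I x c) ->
      exists (x : 'I_n -> R) (time : nat),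
        [/\ runs P (encode_input R I c) (encode_solution x) time,
            (time <= C * n)%N
          & profit_maximal I (critical_lp_feasible I c) x].
Proof.
have [K hK] := ev_main R.
(* n + 1 <= 2 n, because a color with excess 1 requires an item *)
exists (Program fns main_code), (2 * K)%N => n m I c [z [[zf zmax] [_ zc]]].
have [|x [t run time] xmax] := hK n m I c.
  exists z; split=> [|y /critical_lp_feasible_ckp]; last exact: zmax.
  by case: zf => hw _ hz; split; rewrite ?sum_color_sign.
have n_gt0 : (0 < n)%N.
  case: n I z zc {hK zf zmax x run time xmax} => // I z.
  rewrite /color_excess /color_sum !big_ord0 subrr => /eqP.
  by rewrite eq_sym oner_eq0.
exists x, t; split=> //; apply: leq_trans time _.
by rewrite addn0 -mulnA mulnCA leq_mul2l; apply/orP; right; lia.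
Qed.
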